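(* Let $(S,\mathcal{F},\mathcal{L})$ be a $p$-local finite group and $R_1,\dots,R_n$ $\mathcal{F}$-centric subgroups of $S$ such that $\Gamma_R$ is a Robinson group model for $\mathcal{F}$. For each $\mathcal{F}$-centric $P\leq S$ let $\psi_P:\mathrm{Aut}_{\mathcal{T}^c_S(\Gamma_R)}(P)=N_{\Gamma_R}(P)\to\mathrm{Aut}_{\mathcal{L}}(P)$ be the group homomorphism $a_1\cdots a_k\mapsto\widehat{a_1}\circ\cdots\circ\widehat{a_k}$, and put $\Theta(P)=\mathrm{Ker}(\psi_P)$. Then $\Theta$ is a signalizer functor for $\Gamma_R$.
   Context: Fusion systems. $p$ is a prime, $S$ a finite $p$-group. A fusion system $\mathcal{F}$ on $S$ is a category whose objects are the subgroups of $S$, whose morphism sets $\mathrm{Hom}_{\mathcal{F}}(P,Q)$ consist of injective group homomorphisms and contain all those induced by conjugation by elements of $S$, and in which every morphism is an $\mathcal{F}$-isomorphism followed by an inclusion. Subgroups are $\mathcal{F}$-conjugate if isomorphic in $\mathcal{F}$. $P$ is fully centralized (resp. fully normalized) if $|C_S(P)|\ge|C_S(P')|$ (resp. $|N_S(P)|\ge |N_S(P')|$) for all $\mathcal{F}$-conjugates $P'$. $\mathcal{F}$ is saturated if (i) every fully normalized $P$ is fully centralized and $\mathrm{Aut}_S(P)\in \mathrm{Syl}_p(\mathrm{Aut}_{\mathcal{F}}(P))$, and (ii) if $\phi\in\mathrm{Hom}_{\mathcal{F}}(P,S)$ has $\phi(P)$ fully centralized, then $\phi$ extends to a morphism in $\mathrm{Hom}_{\mathcal{F}}(N_\phi,S)$,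 where $N_\phi=\{g\in N_S(P): \phi c_g\phi^{-1}\in\mathrm{Aut}_S(\phi(P))\}$. $P$ is $\mathcal{F}$-centric if $C_S(P')\le P'$ for all $\mathcal{F}$-conjugates $P'$ of $P$. Linking systems. A centric linking system associated with a saturated $\mathcal{F}$ is a finite category $\mathcal{L}$ whose objects are the $\mathcal{F}$-centric subgroups of $S$, with functors $\delta$ from the transporter category of $S$ on these objects (morphisms $P\to Q$: $N_S(P,Q)=\{g\in S: gPg^{-1}\le Q\}$) to $\mathcal{L}$, identity on objects, and $\pi:\mathcal{L}\to\mathcal{F}$, inclusion on objects and surjective on morphism sets, such that: $C_S(P)=Z(P)$ acts freely on $\mathrm{Mor}_{\mathcal{L}}(P,Q)$ by right composition via $\delta_{P,P}$ and $\pi$ induces a bijection $\mathrm{Mor}_{\mathcal{L}}(P,Q)/C_S(P)\cong\mathrm{Hom}_{\mathcal{F}}(P,Q)$; $\pi(\delta_{P,Q}(g))=c_g$; and $\phi\circ\delta_{P,P}(g)=\delta_{Q,Q}(\pi(\phi)(g))\circ\phi$ for $\phi\in \mathrm{Mor}_{\mathcal{L}}(P,Q)$, $g\in P$. Write $\delta_P=\delta_{P,P}:N_S(P)\to\mathrm{Aut}_{\mathcal{L}}(P)$. A $p$-local finite group is a triple $(S,\mathcal{F},\mathcal{L})$ with $\mathcal{F}$ saturated on $S$ and $\mathcal{L}$ an associated centric linking system. For $P\le Q$, $P'\le Q'$, a morphism $\phi\in\mathrm{Mor}_{\mathcal{L}}(Q,Q')$ is an extension of $\psi\in\mathrm{Mor}_{\mathcal{L}}(P,P')$,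 and $\psi$ a restriction of $\phi$, if $\delta_{P',Q'}(1)\circ\psi=\phi\circ\delta_{P,Q}(1)$. Group models. A finite $p$-subgroup $S$ of a discrete group $\mathcal{G}$ is a Sylow $p$-subgroup if every $p$-subgroup of $\mathcal{G}$ is conjugate to a subgroup of $S$. $\mathcal{F}_S(\mathcal{G})$ has as objects the subgroups of $S$ and as morphisms the conjugation maps $c_g:P\to Q$ with $g\in\mathcal{G}$, $gPg^{-1}\le Q$. $\mathcal{G}$ is a group model for $\mathcal{F}$ if $S$ is a Sylow $p$-subgroup of $\mathcal{G}$ and $\mathcal{F}_S(\mathcal{G})=\mathcal{F}$. A signalizer functor on a group model $\mathcal{G}$ is an assignment $P\mapsto\theta(P)$, for every $\mathcal{F}$-centric $P\le S$, such that $\theta(P)$ is a complement of $Z(P)$ in $C_{\mathcal{G}}(P)$, and if $g\in\mathcal{G}$ with $gPg^{-1}\le Q$ then $\theta(Q)\le g\theta(P)g^{-1}$. Robinson model. $\Gamma_R=\mathrm{Aut}_{\mathcal{L}}(S)\underset{N_S(R_1)}{*}\mathrm{Aut}_{\mathcal{L}}(R_1)*\cdots\underset{N_S(R_n)}{*}\mathrm{Aut}_{\mathcal{L}}(R_n)$, where each $N_S(R_j)$ is amalgamated via $\delta_S:N_S(R_j)\to\mathrm{Aut}_{\mathcal{L}}(S)$ and $\delta_{R_j}:N_S(R_j)\to\mathrm{Aut}_{\mathcal{L}}(R_j)$; $S$ and its subgroups are embedded in $\Gamma_R$ via $\delta_S:S\to\mathrm{Aut}_{\mathcal{L}}(S)\le\Gamma_R$.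 Put $R_0=S$. The maps $\psi_P$. Let $P\le S$ be $\mathcal{F}$-centric. Every $g\in N_{\Gamma_R}(P)$ can be written $g=a_1\cdots a_k$ with subgroups $P=P_0,P_1,\dots,P_k=P$ of $S$ and indices $j(i)$ such that $a_i\in\mathrm{Aut}_{\mathcal{L}}(R_{j(i)})$, $P_i,P_{i-1}\le N_S(R_{j(i)})$ and $a_i\,\delta_{R_{j(i)}}(P_i)\,a_i^{-1}=\delta_{R_{j(i)}}(P_{i-1})$. Each $a_i$ has a unique extension $\widetilde{a_i}:\langle R_{j(i)},P_i\rangle\to\langle R_{j(i)},P_{i-1}\rangle$ in $\mathcal{L}$, which is an isomorphism and has a unique restriction $\widehat{a_i}:P_i\to P_{i-1}$ in $\mathcal{L}$, also an isomorphism; $\psi_P(g)=\widehat{a_1}\circ\cdots\circ\widehat{a_k}$ is well defined and a group homomorphism. $\mathcal{T}^c_S(\Gamma_R)$ is the transporter category of $\Gamma_R$ on the $\mathcal{F}$-centric subgroups of $S$, so $\mathrm{Aut}_{\mathcal{T}^c_S(\Gamma_R)}(P)=N_{\Gamma_R}(P)$. *)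

(* Defs.v *)
From HB Require Import structures.
From mathcomp Require Import all_boot all_fingroup center pgroup.
From mathcomp Require Import boolp classical_sets.

Set Implicit Arguments.
Unset Strict Implicit.
Unset Printing Implicit Defensive.

Import GroupScope.

(* MathComp's conjugation is x ^ g = g^-1 x g, so the conjugation map
   c_g : x |-> g x g^-1 is x |-> x ^ g^-1, and g P g^-1 is P :^ g^-1.         *)

Section FusionSystems.

Variable gT : finGroupType.

(* A morphism P -> Q is represented by a function gT -> gT whose values outside
   P are irrelevant: by [fhom_ext], Hom(P, Q) is a union of classes for
   pointwise equality on P.  Identities are the case x = 1 of [fhom_conj].    *)
Record fusion_system (S : {group gT}) := FusionSystem {
  fhom :> {group gT} -> {group gT} -> pred (gT -> gT);
  fhom_obj : forall P Q f, fhom P Q f -> P \subset S /\ Q \subset S;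
  fhom_ext : forall (P Q : {group gT}) (f g : gT -> gT),
    {in P, f =1 g} -> fhom P Q f -> fhom P Q g;
  fhom_inj : forall P Q f, fhom P Q f ->
    [/\ {in P &, {morph f : x y / x * y}}, {in P &, injective f}
      & {in P, forall x, f x \in Q}];
  fhom_conj : forall (P Q : {group gT}) x, P \subset S -> Q \subset S ->
    x \in S -> P :^ x^-1 \subset Q -> fhom P Q (fun y => y ^ x^-1);
  fhom_comp : forall P Q T f g,
    fhom P Q f -> fhom Q T g -> fhom P T (g \o f);
  (* every morphism is an isomorphism onto some P' followed by the inclusion
     of P' into Q *)
  fhom_iso : forall P Q f, fhom P Q f -> exists2 P' : {group gT},
    P' \subset Q & exists g, [/\ fhom P P' f, fhom P' P g,
                                 {in P, cancel f g} & {in P', cancel g f}]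
}.

Variables (p : nat) (S : {group gT}) (F : fusion_system S).
Implicit Types (P Q : {group gT}) (f : gT -> gT).

Definition fconj P Q : bool :=
  [exists f : {ffun gT -> gT}, exists g : {ffun gT -> gT},
    [&& F P Q f, F Q P g, [forall x in P, g (f x) == x]
      & [forall y in Q, f (g y) == y]]].

Definition fully_centralized P : bool :=
  [forall P' : {group gT}, fconj P P' ==> (#|'C_S(P')| <= #|'C_S(P)|)].

Definition fully_normalized P : bool :=
  [forall P' : {group gT}, fconj P P' ==> (#|'N_S(P')| <= #|'N_S(P)|)].

Definition Aut_fus P : {set {perm gT}} := [set a in Aut P | F P P a].

Definition Aut_conj P : {set {perm gT}} := conj_aut P @* 'N_S(P).

(* The g in N_S(P) such that f c_g f^-1 = c_h on f(P) for some h in N_S(f(P)). *)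
Definition N_ext P f : {set gT} :=
  [set g in 'N_S(P) | [exists h in 'N_S(f @: P),
     [forall x in P, f (x ^ g^-1) == (f x) ^ h^-1]]].

Definition saturated : Prop :=
  (forall P, P \subset S -> fully_normalized P ->
     fully_centralized P /\ p.-Sylow(Aut_fus P) (Aut_conj P)) /\
  (forall (P P' N : {group gT}) f, F P S f -> P' :=: f @: P -> fully_centralized P' ->
     N :=: N_ext P f -> exists2 h, F N S h & {in P, h =1 f}).

Definition centric P : bool :=
  [forall P' : {group gT}, fconj P P' ==> ('C_S(P') \subset P')].

Record cobj := CObj {
  cobj_group :> {group gT};
  cobj_centric : (cobj_group \subset S) && centric cobj_group
}.

HB.instance Definition _ := [isSub for cobj_group].
HB.instance Definition _ := [Finite of cobj by <:].

Lemma top_centric : (S \subset S) && centric S.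
Proof.
rewrite subxx /=; apply/forallP => P; apply/implyP => /existsP[f /existsP[g]].
case/and4P => Ff Fg _ /forall_inP fK.
have [_ sPS] := fhom_obj Ff; have [_ _ gS] := fhom_inj Fg.
have sSP : #|S| <= #|P|.
  have [_ finj fP] := fhom_inj Ff.
  rewrite -(card_in_imset finj); apply: subset_leq_card.
  by apply/fintype.subsetP => _ /imsetP[x Sx ->]; apply: fP.
suff -> : P = S by apply: subsetIl.
by apply/val_inj/eqP; rewrite eqEcard sPS.
Qed.

Definition top_cobj : cobj := CObj top_centric.

(* The transporter N_S(P, Q) = Mor(P, Q) in the transporter category of S. *)
Definition transp (P Q : cobj) : {set gT} :=
  [set g in S | P :^ g^-1 \subset Q].

Definition trans (P Q : cobj) := {g : gT | g \in transp P Q}.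

Definition Trans (P Q : cobj) g (Ng : g \in transp P Q) : trans P Q :=
  exist _ g Ng.

Lemma transp1 (P Q : cobj) : P \subset Q -> 1 \in transp P Q.
Proof. by move=> sPQ; rewrite inE group1 invg1 conjsg1. Qed.

Definition tincl (P Q : cobj) (sPQ : P \subset Q) : trans P Q :=
  Trans (transp1 sPQ).

Lemma transpV (P : cobj) g : g \in transp P P -> g^-1 \in transp P P.
Proof.
rewrite !inE groupV invgK => /andP[-> nPg]; rewrite sub_conjg.
have /eqP defP : P :^ g^-1 == P by rewrite eqEcard nPg cardJg leqnn.
by rewrite defP fintype.subxx.
Qed.

End FusionSystems.

Arguments cobj {gT S} F.
Arguments top_cobj {gT S} F.

Section LinkingSystems.

Variables (gT : finGroupType) (S : {group gT}).

(* [lcomp b a] is the composite "b after a". *)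
Record linking_system (F : fusion_system S) := LinkingSystem {
  mor : cobj F -> cobj F -> finType;
  lid : forall P, mor P P;
  lcomp : forall P Q T, mor Q T -> mor P Q -> mor P T;
  lcompA : forall P Q T U (c : mor T U) (b : mor Q T) (a : mor P Q),
    lcomp c (lcomp b a) = lcomp (lcomp c b) a;
  lcomp1l : forall P Q (a : mor P Q), lcomp (lid Q) a = a;
  lcomp1r : forall P Q (a : mor P Q), lcomp a (lid P) = a;
  (* the functor from the transporter category of S *)
  delta : forall P Q, trans P Q -> mor P Q;
  delta1 : forall P (u : trans P P), sval u = 1 -> delta u = lid P;
  deltaM : forall P Q T (v : trans Q T) (u : trans P Q) (w : trans P T),
    sval w = sval v * sval u -> delta w = lcomp (delta v) (delta u);
  (* the functor to F *)
  proj : forall P Q, mor P Q -> gT -> gT;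
  proj_hom : forall P Q (a : mor P Q), F P Q (proj a);
  proj1 : forall P : cobj F, {in P, proj (lid P) =1 id};
  projM : forall (P Q T : cobj F) (b : mor Q T) (a : mor P Q),
    {in P, proj (lcomp b a) =1 proj b \o proj a};
  proj_surj : forall (P Q : cobj F) f, F P Q f ->
    exists a : mor P Q, {in P, proj a =1 f};
  (* C_S(P) acts freely on mor P Q, and the orbits are the fibres of proj *)
  delta_free : forall P Q (a : mor P Q) (u : trans P P),
    sval u \in 'C_S(P) -> lcomp a (delta u) = a -> sval u = 1;
  proj_orbit : forall (P Q : cobj F) (a b : mor P Q),
    {in P, proj a =1 proj b} <->
    exists2 u : trans P P, sval u \in 'C_S(P) & b = lcomp a (delta u);
  proj_delta : forall (P Q : cobj F) (u : trans P Q),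
    {in P, proj (delta u) =1 fun x => x ^ (sval u)^-1};
  lcomp_delta : forall (P Q : cobj F) (a : mor P Q)
      (u : trans P P) (v : trans Q Q),
    sval u \in P -> sval v = proj a (sval u) ->
    lcomp a (delta u) = lcomp (delta v) a
}.

Variables (F : fusion_system S) (L : linking_system F).

Definition is_iso P Q (a : mor L P Q) : bool :=
  [exists b : mor L Q P, (lcomp a b == lid L Q) && (lcomp b a == lid L P)].

(* Aut_L(P), with composition as product *)
Record laut (P : cobj F) := LAut {
  laut_mor :> mor L P P;
  laut_iso : is_iso laut_mor
}.

HB.instance Definition _ P := [isSub for @laut_mor P].
HB.instance Definition _ P := [Finite of laut P by <:].

Section LautGroup.
Variable P : cobj F.

Lemma lid_iso : is_iso (lid L P).
Proof. by apply/existsP; exists (lid L P); rewrite lcomp1l eqxx. Qed.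

Lemma lcomp_iso (a b : laut P) : is_iso (lcomp a b).
Proof.
have /existsP[a' /andP[/eqP aa' /eqP a'a]] := laut_iso a.
have /existsP[b' /andP[/eqP bb' /eqP b'b]] := laut_iso b.
apply/existsP; exists (lcomp b' a').
by rewrite !lcompA -(lcompA a) bb' -(lcompA b') a'a !lcomp1r aa' b'b !eqxx.
Qed.

Lemma laut_inv_subproof (a : laut P) :
  {b : laut P | lcomp b a = lid L P & lcomp a b = lid L P}.
Proof.
have [b /andP[/eqP ab /eqP ba]] := sigW (existsP (laut_iso a)).
have iso_b : is_iso b by apply/existsP; exists a; rewrite ab ba !eqxx.
by exists (LAut iso_b).
Qed.

Definition laut_one : laut P := LAut lid_iso.
Definition laut_mul (a b : laut P) : laut P := LAut (lcomp_iso a b).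
Definition laut_inv (a : laut P) : laut P := s2val (laut_inv_subproof a).

Lemma laut_mulA : associative laut_mul.
Proof. by move=> a b c; apply: val_inj; rewrite /= lcompA. Qed.

Lemma laut_mul1 : left_id laut_one laut_mul.
Proof. by move=> a; apply: val_inj; rewrite /= lcomp1l. Qed.

Lemma laut_mulV : left_inverse laut_one laut_inv laut_mul.
Proof.
by move=> a; apply: val_inj; rewrite /= (s2valP (laut_inv_subproof a)).
Qed.

HB.instance Definition _ :=
  Finite_isGroup.Build (laut P) laut_mulA laut_mul1 laut_mulV.

Lemma delta_iso (u : trans P P) : is_iso (delta L u).
Proof.
case: u => g Ng; apply/existsP; exists (delta L (Trans (transpV Ng))).
rewrite -!(@deltaM _ L P P P _ _ (Trans (transp1 (fintype.subxx P)))) /= ?mulVg ?mulgV //.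
by rewrite delta1 // eqxx.
Qed.

(* delta_P : N_S(P) -> Aut_L(P), extended by 1 outside N_S(P) *)
Definition deltaN (g : gT) : laut P :=
  if insub g is Some u then LAut (delta_iso u) else 1.

End LautGroup.

(* [b] is an extension of [a], and [a] a restriction of [b]. *)
Definition extension (P P' Q Q' : cobj F) (a : mor L P P') (b : mor L Q Q') :=
  exists (sPQ : P \subset Q) (sPQ' : P' \subset Q'),
    lcomp (delta L (tincl sPQ')) a = lcomp b (delta L (tincl sPQ)).

End LinkingSystems.

Arguments deltaN {gT S F} L P g.
Arguments laut {gT S F} L P.

Section GroupModels.

(* G is a possibly infinite group; S and its subgroups are regarded as subgroups
   of G through i, whose values outside S are irrelevant. *)
Variables (gT : finGroupType) (S : {group gT}) (F : fusion_system S).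
Variables (p : nat) (G : groupType) (i : gT -> G).

Local Open Scope classical_set_scope.

Definition img (P : {set gT}) : set G := i @` [set` P].

Definition lconj (g : G) (A : set G) : set G := [set g * x * g^-1 | x in A].

Definition is_subgroup (A : set G) : Prop :=
  A 1 /\ forall x y, A x -> A y -> A (x * y^-1).

(* not required to be finite *)
Definition is_psubgroup (A : set G) : Prop :=
  is_subgroup A /\ forall x, A x -> exists k, x ^+ (p ^ k)%N = 1.

Definition centralizer (A : set G) : set G :=
  [set g | forall x, A x -> g * x = x * g].

Definition normalizer (A : set G) : set G := [set g | lconj g A = A].

Definition group_model : Prop :=
  [/\ {in S &, {morph i : x y / x * y}},
      {in S &, injective i},
      forall A, is_psubgroup A -> exists g, lconj g A `<=` img S
    & forall (P Q : {group gT}) (f : gT -> gT), F P Q f <->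
        [/\ P \subset S, Q \subset S &
            exists g, {in P, forall x, f x \in Q /\ g * i x * g^-1 = i (f x)}]].

Definition is_complement (K Z C : set G) : Prop :=
  [/\ is_subgroup K, K `<=` C, K `&` Z = [set 1]
    & [set z * k | z in Z & k in K] = C].

Definition signalizer_functor (theta : cobj F -> set G) : Prop :=
  (forall P : cobj F,
     is_complement (theta P) (img 'Z(P)) (centralizer (img P))) /\
  (forall (P Q : cobj F) g, lconj g (img P) `<=` img Q ->
     theta Q `<=` lconj g (theta P)).

End GroupModels.

Section RobinsonModel.

Variables (gT : finGroupType) (S : {group gT}) (F : fusion_system S).
Variables (L : linking_system F) (n : nat) (R : 'I_n -> cobj F).

(* R_0 = S is indexed by None. *)
Definition vertex (v : option 'I_n) : cobj F :=
  if v is Some j then R j else top_cobj F.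

Definition cocone (H : groupType) (f : forall v, laut L (vertex v) -> H) : Prop :=
  (forall v, {morph f v : a b / a * b}) /\
  (forall j, {in 'N_S(R j), forall s,
     f None (deltaN L (vertex None) s) = f (Some j) (deltaN L (vertex (Some j)) s)}).

(* G, with the maps iota v, is the amalgam of the groups Aut_L(R_v) along the
   N_S(R_j), given by its universal property. *)
Definition robinson_amalgam (G : groupType)
    (iota : forall v, laut L (vertex v) -> G) : Prop :=
  cocone iota /\
  forall (H : groupType) (f : forall v, laut L (vertex v) -> H), cocone f ->
    exists2 h : {multiplicative G -> H}, (forall v a, h (iota v a) = f v a) &
      forall h' : {multiplicative G -> H},
        (forall v a, h' (iota v a) = f v a) -> h' =1 h.

Variables (G : groupType) (iota : forall v, laut L (vertex v) -> G).

Definition robinson_emb (s : gT) : G := iota (deltaN L (vertex None) s).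

(* For a in Aut_L(R_v) with a P a^-1 = P' inside Aut_L(R_v), [b] is the
   restriction P -> P' of the extension <R_v, P> -> <R_v, P'> of a. *)
Definition hat v (a : laut L (vertex v)) (P P' : cobj F) (b : mor L P P') : Prop :=
  [/\ P \subset 'N_S(vertex v), P' \subset 'N_S(vertex v),
      (deltaN L (vertex v) @: P) :^ a^-1 = deltaN L (vertex v) @: P'
    & exists (Q Q' : cobj F) (t : mor L Q Q'),
        [/\ Q :=: vertex v <*> P, Q' :=: vertex v <*> P',
            extension a t & extension b t]].

(* [hat_word g c] with c : P -> Q: for some chain P = P_k, ..., P_0 = Q and some
   a_i : P_i -> P_(i-1) as in [hat], g = a_1 ... a_k and c is the composite of
   the corresponding restrictions.  The P_i are taken among the objects of L,
   which loses nothing: they are conjugate to P in F = F_S(G). *)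
Inductive hat_word (P : cobj F) : forall Q : cobj F, G -> mor L P Q -> Prop :=
| hat_nil : hat_word 1 (lid L P)
| hat_cons Q Q' v (a : laut L (vertex v)) (b : mor L Q Q') g (c : mor L P Q) :
    hat a b -> hat_word g c -> hat_word (iota a * g) (lcomp b c).

Local Open Scope classical_set_scope.

(* Every g in N_G(P) is covered by some [hat_word] and the composite depends only
   on g, so neither the choice nor the default value of xget matters. *)
Definition psi (P : cobj F) (g : G) : laut L P :=
  xget 1 [set c : laut L P | hat_word g (laut_mor c)].

Definition Theta (P : cobj F) : set G :=
  [set g | normalizer (img robinson_emb P) g /\ psi P g = 1].

End RobinsonModel.

(* Main.v *)
From HB Require Import structures.
Require Import Defs.
From mathcomp Require Import boolp classical_sets.
From mathcomp Require Import all_boot all_fingroup ssralg ssrnum ssrint zify.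
From mathcomp Require Import cyclic center pgroup nilpotent sylow.

Set Implicit Arguments.
Unset Strict Implicit.
Unset Printing Implicit Defensive.

Import GroupScope.

(** The proof has three independent inputs, and then a short formal argument.

    Linking systems.  In a centric linking system every morphism is a
    monomorphism ([lcomp_mono]) and, thanks to saturation, an epimorphism
    ([lcomp_epi]).  The second fact says that a morphism of F which is trivial on
    a centric subgroup P of Q comes from an element of Z(P): for P normal in Q
    such an automorphism of Q is a p-element, so Sylow's theorem in Aut_F(Q)
    moves it into Aut_S(Q).  Consequently the restriction [hat a b] of the
    extension of a : Aut_L(R_v) exists as soon as a P a^-1 lies in N_S(R_v)
    ([hat_exists], by the extension axiom), is unique ([hat_tagged]), determines a
    ([hat_free]), and is compatible with products, inverses and smaller subgroups.

    The composite along a word depends only on the group element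
    ([hat_word_inj]).  For fixed P each Aut_L(R_v) acts partially on the finite
    set M of all L-morphisms with source P, a sending c to b c when [hat a b].
    These partial actions are free and agree on the amalgamated groups N_S(R_j).
    Any such family extends to honest actions on one finite set containing M
    ([partial_amalgam_action]), because an equivariant injection between free
    K-sets of equal cardinality extends to a bijection.  The universal property
    turns them into an action of the amalgam G; an element g with a word of
    composite c moves the identity of P to c (up to inversion), so c is
    determined by g.

    Every g with g P g^-1 <= S has a word ([hat_word_of_conj]).  This is a fact
    on the Bass-Serre tree of G: the vertices A_v g and the edges N_j g, on which
    G acts from the right, form a tree, P fixes A_None and A_None g, and the path
    joining them must consist of edges fixed by P.  The part of the tree reached
    by words starting at P is a component of the fixed points of P, so that P
    fixes none of the edges that leave it.  If A_None g were outside that part,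
    the signed number of times that a path from A_None to A_None g leaves it would
    be 1; but the signed number of passages through an edge is determined by the
    end points, hence is constant on P-orbits of edges, all of whose sizes are
    multiples of p: the total is divisible by p.  Path-independence
    comes from the universal property of G applied to the semidirect product
    G |x Fun(G, Z) ([cocycle_ex], [cocycle_unique]): a Z-valued weight on the
    edges integrates to a 1-cocycle of G.

    Now Theta(P) is the set of the g that have a word of composite id_P
    ([ThetaP]).  A word of composite c conjugates P as proj c does, so Theta(P)
    centralizes P; if g centralizes P then its composite induces the identity in
    F, hence is delta_P(z) with z in Z(P), and z^-1 g lies in Theta(P).  If
    g P g^-1 = P' <= Q and h has composite id_Q, then restricting the word of h to
    P' and conjugating by a word of g yields a word of composite id_P for
    g^-1 h g. *)

(** * Morphisms of a fusion system *)

Section Fusion.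

Variables (gT : finGroupType) (S : {group gT}) (F : fusion_system S).
Implicit Types (P Q T : {group gT}) (f g : gT -> gT).

Lemma fhom_incl P Q : P \subset Q -> Q \subset S -> F P Q id.
Proof.
move=> sPQ sQS; have sPS := fintype.subset_trans sPQ sQS.
apply: (@fhom_ext _ _ F P Q (fun y => y ^ 1^-1)); first by move=> x _ /=; rewrite invg1 conjg1.
by apply: fhom_conj; rewrite ?group1 // invg1 conjsg1.
Qed.

Lemma fhom_restrict P Q T f : F P Q f -> T \subset P -> F T Q f.
Proof.
move=> Ff sTP; have [sPS _] := fhom_obj Ff.
exact: (fhom_comp (fhom_incl sTP sPS) Ff).
Qed.

Lemma fhom_widen P Q T f : F P Q f -> Q \subset T -> T \subset S -> F P T f.
Proof. by move=> Ff sQT sTS; apply: (fhom_comp Ff (fhom_incl sQT sTS)). Qed.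

Lemma fhom_im_iso P Q f : F P Q f -> exists P' : {group gT},
  [/\ P' :=: f @: P, P' \subset Q, F P P' f &
   exists g, [/\ F P' P g, {in P, cancel f g} & {in P', cancel g f}]].
Proof.
move=> Ff; have [P' sP'Q [g [Ff' Fg fK gK]]] := fhom_iso Ff.
exists P'; split=> //; last by exists g.
apply/eqP; rewrite eqEsubset; apply/andP; split; apply/fintype.subsetP => y.
  move=> P'y; rewrite -(gK y P'y); apply: imset_f.
  by have [_ _] := fhom_inj Fg; apply.
by case/imsetP=> x Px ->; have [_ _] := fhom_inj Ff'; apply.
Qed.

Lemma fhom_codom P Q T f :
  F P Q f -> T \subset S -> {in P, forall x, f x \in T} -> F P T f.
Proof.
move=> Ff sTS fT; have [P' [defP' _ Ff' _]] := fhom_im_iso Ff.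
apply: fhom_widen Ff' _ sTS; rewrite defP'.
by apply/fintype.subsetP => _ /imsetP[x Px ->]; apply: fT.
Qed.

(** Invert g on its image, which contains the image of f. *)
Lemma fhom_factor P Q T f g : F P T f -> F Q T g -> f @: P \subset g @: Q ->
  exists2 h, F P Q h & {in P, g \o h =1 f}.
Proof.
move=> Ff Fg sfg; have [Q' [defQ' _ Fg' [g' [Fg'' gK g'K]]]] := fhom_im_iso Fg.
have [sQ'S _] := fhom_obj Fg''.
have FfQ : F P Q' f.
  apply: fhom_codom Ff sQ'S _ => x Px; rewrite defQ'.
  by apply: (fintype.subsetP sfg); apply: imset_f.
exists (g' \o f); first exact: fhom_comp FfQ Fg''.
by move=> x Px /=; rewrite g'K //; have [_ _] := fhom_inj FfQ; apply.
Qed.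

Lemma fconjI P Q f g : F P Q f -> F Q P g -> {in P, cancel f g} ->
  {in Q, cancel g f} -> fconj F P Q.
Proof.
move=> Ff Fg fK gK; apply/existsP; exists [ffun x => f x].
apply/existsP; exists [ffun x => g x]; apply/and4P; split.
- by apply: fhom_ext Ff => x _; rewrite ffunE.
- by apply: fhom_ext Fg => x _; rewrite ffunE.
- by apply/forall_inP => x Px; rewrite !ffunE fK.
by apply/forall_inP => x Px; rewrite !ffunE gK.
Qed.

Lemma fconjP P Q : fconj F P Q ->
  exists f g, [/\ F P Q f, F Q P g, {in P, cancel f g} & {in Q, cancel g f}].
Proof.
case/existsP=> f /existsP[g /and4P[Ff Fg /forall_inP fK /forall_inP gK]].
by exists f, g; split=> // x /[dup] ? => [/fK|/gK] /eqP.
Qed.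

Lemma fconj_trans P Q T : fconj F P Q -> fconj F Q T -> fconj F P T.
Proof.
case/fconjP=> f [f' [Ff Ff' fK f'K]] /fconjP[g [g' [Fg Fg' gK g'K]]].
have [_ _ fQ] := fhom_inj Ff; have [_ _ g'Q] := fhom_inj Fg'.
apply: (fconjI (fhom_comp Ff Fg) (fhom_comp Fg' Ff')) => x Px /=.
  by rewrite gK ?fK ?fQ.
by rewrite f'K ?g'K ?g'Q.
Qed.

Lemma fconj_im P Q T f : F P Q f -> T :=: f @: P -> fconj F P T.
Proof.
move=> Ff defT; have [P' [defP' _ Ff' [g [Fg fK gK]]]] := fhom_im_iso Ff.
have -> : T = P' by apply: val_inj; rewrite /= defT.
exact: fconjI Ff' Fg fK gK.
Qed.

Lemma fconj_centric P Q : centric F P -> fconj F P Q -> centric F Q.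
Proof.
move=> /forallP cP cPQ; apply/forallP => T; apply/implyP => cQT.
by apply: (implyP (cP T)); apply: fconj_trans cQT.
Qed.

(** A conjugate of Q contains a conjugate of P, which contains the
    centralizers of both. *)
Lemma centric_over P Q :
  centric F P -> P \subset Q -> centric F Q.
Proof.
move=> /forallP cP sPQ; apply/forallP => T; apply/implyP.
case/fconjP => f [g [Ff Fg fK gK]].
have [P' [defP' sP'T _ _]] := fhom_im_iso (fhom_restrict Ff sPQ).
have := implyP (cP P') (fconj_im (fhom_restrict Ff sPQ) defP').
move=> sCP'; apply: fintype.subset_trans (fintype.subset_trans sCP' sP'T).
by apply: setIS; apply: centS.
Qed.

Lemma cobj_eq (P Q : cobj F) : P :=: Q -> P = Q.
Proof. by move=> eqPQ; apply: val_inj; apply: val_inj. Qed.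

Lemma cobj_sub (P : cobj F) : P \subset S.
Proof. by have /andP[] := cobj_centric P. Qed.

Lemma cobj_cent (P : cobj F) : 'C_S(P) \subset P.
Proof.
have /andP[sPS /forallP/(_ P)/implyP] := cobj_centric P; apply.
by apply: (fconjI (fhom_incl (fintype.subxx P) sPS) (fhom_incl (fintype.subxx P) sPS)).
Qed.

Lemma cobj_over (P : cobj F) (Q : {group gT}) : P \subset Q -> Q \subset S ->
  exists Q' : cobj F, Q' :=: Q.
Proof.
move=> sPQ sQS; have /andP[_ cP] := cobj_centric P.
have cQ : (Q \subset S) && centric F Q by rewrite sQS (centric_over cP).
by exists (CObj cQ).
Qed.

Lemma cobj_im (P : cobj F) (Q : {group gT}) f : F P Q f ->
  exists P' : cobj F, P' :=: f @: P.
Proof.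
move=> Ff; have [P' [defP' _ Ff' _]] := fhom_im_iso Ff.
have /andP[_ cP] := cobj_centric P.
have cP' : (P' \subset S) && centric F P'.
  by have [_ ->] := fhom_obj Ff'; rewrite (fconj_centric cP) // (fconj_im Ff).
by exists (CObj cP').
Qed.

End Fusion.

(** * Morphisms of a linking system *)

Section Linking.

Variables (gT : finGroupType) (S : {group gT}) (F : fusion_system S).
Variable L : linking_system F.
Implicit Types (P Q T : cobj F).

Local Notation dN P g := (laut_mor (deltaN L P g)).

Definition linc P Q (sPQ : P \subset Q) : mor L P Q := delta L (tincl sPQ).

Lemma delta_eq P Q (u v : trans P Q) : sval u = sval v -> delta L u = delta L v.
Proof. by move=> uv; congr delta; apply: val_inj. Qed.

Lemma transpN P g : (g \in transp P P) = (g \in 'N_S(P)).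
Proof.
by rewrite inE [RHS]inE -[X in _ = _ && X]groupV [X in _ = _ && X]inE.
Qed.

Lemma deltaNE P g (Ng : g \in transp P P) : dN P g = delta L (Trans Ng).
Proof.
by rewrite /deltaN insubT /=; apply: delta_eq.
Qed.

Lemma deltaNM P : {in 'N_S(P) &, {morph deltaN L P : x y / x * y}}.
Proof.
move=> x y Nx Ny; apply: val_inj => /=.
have Nxy : x * y \in transp P P by rewrite transpN groupM.
rewrite -transpN in Nx; rewrite -transpN in Ny.
by rewrite (deltaNE Nx) (deltaNE Ny) (deltaNE Nxy); apply: deltaM.
Qed.

Lemma deltaN1 P : deltaN L P 1 = 1.
Proof.
have N1 := group1 ('N_S(P)).
by apply: (mulgI (deltaN L P 1)); rewrite -deltaNM // !mulg1.
Qed.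

Lemma deltaNV P : {in 'N_S(P), {morph deltaN L P : x / x^-1}}.
Proof.
move=> x Nx; apply: (mulgI (deltaN L P x)).
by rewrite -deltaNM ?groupV // !mulgV deltaN1.
Qed.

Lemma proj_deltaN P g : g \in 'N_S(P) -> {in P, proj (dN P g) =1 conjg^~ g^-1}.
Proof.
by rewrite -transpN => Ng x Px; rewrite deltaNE proj_delta.
Qed.

Lemma cobj_cent_norm P z : z \in 'C_S(P) -> z \in 'N_S(P).
Proof. by apply: (fintype.subsetP (setIS _ (cent_sub _))). Qed.

Lemma cobj_norm P x : x \in P -> x \in 'N_S(P).
Proof.
by move=> Px; rewrite inE (fintype.subsetP (cobj_sub P)) // (fintype.subsetP (normG P)).
Qed.

Lemma deltaN_free P Q (a : mor L P Q) z :
  z \in 'C_S(P) -> lcomp a (dN P z) = a -> z = 1.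
Proof.
move=> Cz; have Nz := cobj_cent_norm Cz; rewrite -transpN in Nz.
by rewrite (deltaNE Nz) => /delta_free; apply.
Qed.

Lemma proj_eq P Q (a b : mor L P Q) : {in P, proj a =1 proj b} ->
  exists2 z, z \in 'C_S(P) & b = lcomp a (dN P z).
Proof.
case/proj_orbit => -[z Nz] /= Cz ->; exists z => //.
by rewrite (deltaNE Nz).
Qed.

Lemma deltaN_comm P Q (a : mor L P Q) x : x \in P ->
  lcomp a (dN P x) = lcomp (dN Q (proj a x)) a.
Proof.
move=> Px; have [_ _ aQ] := fhom_inj (proj_hom a).
have Nx : x \in transp P P by rewrite transpN cobj_norm.
have Nax : proj a x \in transp Q Q by rewrite transpN cobj_norm // aQ.
by rewrite (deltaNE Nx) (deltaNE Nax); apply: lcomp_delta.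
Qed.

Lemma deltaN_linc P Q (sPQ : P \subset Q) g : g \in 'N_S(P) -> g \in 'N_S(Q) ->
  lcomp (dN Q g) (linc sPQ) = lcomp (linc sPQ) (dN P g).
Proof.
rewrite -!transpN => NPg NQg; rewrite (deltaNE NPg) (deltaNE NQg).
have Ng : g \in transp P Q.
  move: NPg; rewrite !inE => /andP[-> sPP] /=.
  by apply: fintype.subset_trans sPP _.
by rewrite -!(@deltaM _ _ _ _ _ _ _ _ _ (Trans Ng)) //= ?mulg1 ?mul1g.
Qed.

Lemma lincM P Q T (sPQ : P \subset Q) (sQT : Q \subset T) (sPT : P \subset T) :
  lcomp (linc sQT) (linc sPQ) = linc sPT.
Proof. by symmetry; apply: deltaM; rewrite /= mulg1. Qed.

Lemma linc1 P (sPP : P \subset P) : linc sPP = lid L P.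
Proof. exact: delta1. Qed.

Lemma proj_linc P Q (sPQ : P \subset Q) : {in P, proj (linc sPQ) =1 id}.
Proof. by move=> x Px; rewrite proj_delta //= invg1 conjg1. Qed.

Lemma proj_lcomp P Q T (b : mor L Q T) (a : mor L P Q) x :
  x \in P -> proj (lcomp b a) x = proj b (proj a x).
Proof. by move=> Px; rewrite projM. Qed.

Lemma proj_in P Q (a : mor L P Q) x : x \in P -> proj a x \in Q.
Proof. by have [_ _ aQ] := fhom_inj (proj_hom a); apply: aQ. Qed.

Lemma proj_injective P Q (a : mor L P Q) : {in P &, injective (proj a)}.
Proof. by have [] := fhom_inj (proj_hom a). Qed.

Lemma proj_morph P Q (a : mor L P Q) : {in P &, {morph proj a : x y / x * y}}.
Proof. by have [] := fhom_inj (proj_hom a). Qed.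

Lemma proj_conj P Q (a : mor L P Q) x y : x \in P -> y \in P ->
  proj a (x ^ y) = proj a x ^ proj a y.
Proof.
move=> Px Py; have Pxy : x ^ y \in P by rewrite groupJ.
have : proj a (y * x ^ y) = proj a (x * y) by rewrite -conjgC.
rewrite (proj_morph a Py Pxy) (proj_morph a Px Py) => E.
by rewrite [RHS]conjgE -E mulKg.
Qed.

(** Two lifts of one morphism of F differ by an element of C_S(P), which acts
    freely. *)
Lemma lcomp_mono P Q T (a : mor L Q T) (b c : mor L P Q) :
  lcomp a b = lcomp a c -> b = c.
Proof.
move=> eq_abc; have /proj_eq[z Cz def_c] : {in P, proj b =1 proj c}.
  move=> x Px; apply: (@proj_injective _ _ a); rewrite ?proj_in //.
  by rewrite -!proj_lcomp // eq_abc.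
move: eq_abc; rewrite def_c lcompA => /esym/(deltaN_free Cz) ->.
by rewrite deltaN1 /= lcomp1r.
Qed.

(** Lift a factorization in F; the error is an element of C_S(P), absorbed in the
    right factor. *)
Lemma lcomp_factor P Q T (a : mor L P T) (b : mor L Q T) :
  proj a @: P \subset proj b @: Q -> exists c : mor L P Q, lcomp b c = a.
Proof.
move=> sab; have [h Fh bh] := fhom_factor (proj_hom a) (proj_hom b) sab.
have [c def_c] := proj_surj L Fh.
have /proj_eq[z Cz ->] : {in P, proj (lcomp b c) =1 proj a}.
  by move=> x Px; rewrite proj_lcomp // def_c // -bh.
by exists (lcomp c (dN P z)); rewrite lcompA.
Qed.

Lemma lcomp_restrict P Q P' Q' (a : mor L P Q) (sP : P' \subset P)
    (sQ : Q' \subset Q) : {in P', forall x, proj a x \in Q'} ->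
  exists a' : mor L P' Q', lcomp (linc sQ) a' = lcomp a (linc sP).
Proof.
move=> aQ'; apply: lcomp_factor; apply/fintype.subsetP => _ /imsetP[x P'x ->].
rewrite proj_lcomp // proj_linc //; apply/imsetP; exists (proj a x); rewrite ?aQ' //.
by rewrite proj_linc ?aQ'.
Qed.

Lemma fhom_lift_iso P Q f g : F P Q f -> F Q P g -> {in P, cancel f g} ->
    {in Q, cancel g f} ->
  exists (a : mor L P Q) (b : mor L Q P),
    [/\ {in P, proj a =1 f}, {in Q, proj b =1 g}, lcomp a b = lid L Q
      & lcomp b a = lid L P].
Proof.
move=> Ff Fg fK gK; have [a def_a] := proj_surj L Ff.
have [_ _ gP] := fhom_inj Fg; have [_ _ fQ] := fhom_inj Ff.
have [|b ab1] := @lcomp_factor _ _ _ (lid L Q) a.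
  apply/fintype.subsetP => _ /imsetP[x Qx ->]; rewrite proj1 //=.
  apply/imsetP; exists (g x); first exact: gP.
  by rewrite def_a ?gP ?gK.
exists a, b; split=> //.
  move=> x Qx; apply: (@proj_injective _ _ a); rewrite ?proj_in ?gP //.
  by rewrite -proj_lcomp // ab1 proj1 // def_a ?gP ?gK.
by apply: (lcomp_mono (a := a)); rewrite lcompA ab1 lcomp1l lcomp1r.
Qed.

Lemma lcomp_iso_linc P Q (a : mor L P Q) :
  exists (P1 : cobj F) (sP1 : P1 \subset Q) (b : mor L P P1) (b' : mor L P1 P),
    [/\ a = lcomp (linc sP1) b, lcomp b b' = lid L P1, lcomp b' b = lid L P
      & P1 :=: proj a @: P].
Proof.
have [P1 defP1] := cobj_im (proj_hom a).
have sP1 : P1 \subset Q.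
  by rewrite defP1; apply/fintype.subsetP => _ /imsetP[x Px ->]; apply: proj_in.
have [|b def_b] := @lcomp_factor _ _ _ a (linc sP1).
  rewrite -defP1; apply/fintype.subsetP => x P1x; apply/imsetP.
  by exists x; rewrite ?proj_linc.
have proj_b : {in P, proj b =1 proj a}.
  by move=> x Px; rewrite -def_b proj_lcomp // proj_linc ?proj_in.
have [|b' bb'] := @lcomp_factor _ _ _ (lid L P1) b.
  rewrite (eq_in_imset (@proj1 _ _ _ L P1)) imset_id defP1.
  by rewrite (eq_in_imset proj_b).
exists P1, sP1, b, b'; split=> //.
by apply: (lcomp_mono (a := b)); rewrite lcompA bb' lcomp1l lcomp1r.
Qed.

End Linking.

(** * Morphisms of a linking system are epimorphisms *)

Section AutFus.

Variables (gT : finGroupType) (S : {group gT}) (F : fusion_system S).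

Lemma Aut_fus_group_set (P : {group gT}) : P \subset S -> group_set (Aut_fus F P).
Proof.
move=> sPS; apply/group_setP; split=> [|a b].
  rewrite inE group1; apply: (fhom_ext _ (fhom_incl F (fintype.subxx P) sPS)).
  by move=> x _; rewrite perm1.
rewrite inE => /andP[Aa Fa]; rewrite inE => /andP[Ab Fb].
rewrite inE groupM //=.
by apply: fhom_ext (fhom_comp Fa Fb) => x _; rewrite permM.
Qed.

Lemma fhom_aut (P : {group gT}) f : F P P f ->
  exists2 a, a \in Aut_fus F P & {in P, a =1 f}.
Proof.
move=> Ff; have [fM finj fP] := fhom_inj Ff.
pose m := Morphism fM.
have injm : 'injm m by apply/injmP.
have mP : m @* P = P.
  apply/eqP; rewrite eqEcard card_injm // leqnn andbT morphimEdom.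
  by apply/fintype.subsetP => _ /imsetP[x Px ->]; apply: fP.
have eqf : {in P, aut injm mP =1 f} by move=> x Px; rewrite autE.
exists (aut injm mP) => //; rewrite inE Aut_aut /=.
by apply: fhom_ext Ff => x Px; rewrite eqf.
Qed.

Lemma fully_normalized_ex (P : {group gT}) : P \subset S ->
  exists2 Q, fconj F P Q & fully_normalized F Q.
Proof.
move=> sPS; have FP := fhom_incl F (fintype.subxx P) sPS.
have cPP : fconj F P P by apply: (fconjI FP FP).
case: (@arg_maxnP _ P (fconj F P) (fun Q => #|'N_S(Q)|) cPP) => Q cPQ maxQ.
exists Q => //; apply/forallP => T; apply/implyP => cQT.
by apply: maxQ; apply: fconj_trans cQT.
Qed.

End AutFus.

Section Epi.

Variables (p : nat) (gT : finGroupType) (S : {group gT}) (F : fusion_system S).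
Variable L : linking_system F.
Hypotheses (pS : p.-group S) (satF : saturated p F).
Implicit Types (P Q T : cobj F).

Local Notation dN P g := (laut_mor (deltaN L P g)).

(** As C_S(P) <= P, an automorphism a of Q which is trivial on P satisfies
    a(g) = z g with z in P, whence a^k(g) = z^k g and a^|P| = 1. *)
Lemma p_elt_of_fix_normal P Q (sPQ : P \subset Q) (a : mor L Q Q) b :
  P <| Q -> lcomp a (linc L sPQ) = linc L sPQ -> b \in Aut_fus F Q ->
  {in Q, b =1 proj a} -> p.-elt b.
Proof.
move=> nPQ aP; rewrite inE => /andP[Ab _] ba.
have fixP x : x \in P -> proj a x = x.
  move=> Px; have := proj_lcomp a (linc L sPQ) Px.
  by rewrite aP !proj_linc.
have sPQ' := fintype.subsetP sPQ.
have zP g : g \in Q -> proj a g * g^-1 \in P.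
  move=> Qg.
  apply: (fintype.subsetP (cobj_cent P)); rewrite inE; apply/andP; split.
    by rewrite groupM ?groupV // (fintype.subsetP (cobj_sub Q)) ?proj_in.
  apply/centP => x Px; apply: commute_sym; apply/commgP/conjg_fixP.
  have Pxg : x ^ g \in P by rewrite memJ_norm // (fintype.subsetP (normal_norm nPQ)).
  have Qx := sPQ' _ Px; have Qxg := sPQ' _ Pxg.
  have : proj a (g * x ^ g) = proj a (x * g) by rewrite -conjgC.
  rewrite (proj_morph a Qg Qxg) (proj_morph a Qx Qg) (fixP x) // (fixP (x ^ g)) // => E.
  by rewrite conjgM [x ^ _]conjgE -E mulKg conjgK.
have bX g k : g \in Q -> (b ^+ k) g = (proj a g * g^-1) ^+ k * g.
  move=> Qg; elim: k => [|k IHk]; first by rewrite perm1 mul1g.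
  have Pzk := groupX k (zP g Qg); have Qzk := sPQ' _ Pzk.
  rewrite expgSr permM IHk ba ?groupM // (proj_morph a Qzk Qg) fixP // expgSr.
  by rewrite -!mulgA mulVg mulg1.
rewrite /p_elt; apply: (@pnat_dvd _ #|P|); last exact: pgroupS (cobj_sub P) pS.
rewrite order_dvdn; apply/eqP; apply: (eq_Aut (A := Q)); rewrite ?groupX ?group1 //.
move=> g Qg; rewrite bX // perm1; rewrite (_ : _ ^+ _ = 1) ?mul1g //.
by apply/eqP; rewrite -order_dvdn order_dvdG // zP.
Qed.

(** By [p_elt_of_fix_normal] and Sylow's theorem, a is conjugate in Aut_L(Q) to
    some delta_Q(w).  Triviality on P puts w in the centralizer of the conjugate
    of P, hence in that conjugate, so a itself is delta_Q(u) with u in Z(P), and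
    freeness gives u = 1. *)
Lemma linc_fix_fully_normalized P Q (sPQ : P \subset Q) (a : mor L Q Q) :
  P <| Q -> fully_normalized F Q -> lcomp a (linc L sPQ) = linc L sPQ ->
  a = lid L Q.
Proof.
move=> nPQ nQ aP; have sQS := cobj_sub Q.
pose A := Group (Aut_fus_group_set F sQS).
have [b Ab ba] := fhom_aut (proj_hom a).
have pb := p_elt_of_fix_normal nPQ aP Ab ba.
have [_ sylQ] := satF.1 _ sQS nQ.
have sbA : <[b]> \subset A by rewrite cycle_subG.
have [t At] := Sylow_subJ (G := A) sylQ sbA pb.
rewrite cycle_subG => /imsetP[c /morphimP[g nQg Ng ->] def_b].
have AtV : t^-1 \in A by rewrite groupV.
have Ft : F Q Q t by move: At; rewrite inE => /andP[].
have FtV : F Q Q t^-1 by move: AtV; rewrite inE => /andP[].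
have [|| X [X' [def_X def_X' XX' X'X]]] := fhom_lift_iso L Ft FtV.
- by move=> y _; apply: permK.
- by move=> y _; apply: permKV.
have NgV : g^-1 \in 'N_S(Q) by rewrite groupV.
have /proj_eq[z Cz] : {in Q, proj (lcomp X (dN Q g^-1)) =1 proj (lcomp a X)}.
  move=> y Qy; rewrite !proj_lcomp // proj_deltaN // invgK.
  rewrite !def_X ?memJ_norm // -ba; last by rewrite -def_X ?proj_in.
  by rewrite def_b conjgE -!permM mulKVg permM norm_conj_autE.
rewrite -lcompA -/(laut_mul _ _); pose w := g^-1 * z.
have -> : lcomp (dN Q g^-1) (dN Q z) = dN Q w.
  by rewrite /w deltaNM // cobj_cent_norm.
have {NgV Cz} Nw : w \in 'N_S(Q) by rewrite groupM // cobj_cent_norm.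
move: w Nw => {g nQg Ng def_b z} w Nw aX.
have def_a : a = lcomp X (lcomp (dN Q w) X').
  by rewrite lcompA -aX -lcompA XX' lcomp1r.
have sPQ' := fintype.subsetP sPQ.
have fixP x : x \in P -> proj a x = x.
  move=> Px; have := proj_lcomp a (linc L sPQ) Px.
  by rewrite aP !proj_linc.
have XX'x x : x \in Q -> proj X (proj X' x) = x.
  by move=> Qx; rewrite -proj_lcomp // XX' proj1.
have [P1 defP1] := cobj_im (proj_hom (lcomp X' (linc L sPQ))).
have Cw : w \in 'C_S(P1).
  have [Sw nQw] := setIP Nw; rewrite inE Sw; apply/centP => y.
  rewrite defP1 => /imsetP[x Px ->]; rewrite proj_lcomp // proj_linc //.
  have Qx := sPQ' _ Px; have Qy : proj X' x \in Q by apply: proj_in.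
  apply: commute_sym; apply/commgP/conjg_fixP.
  have Qyw : proj X' x ^ w^-1 \in Q by rewrite memJ_norm // groupV.
  suff {1}<- : proj X' x ^ w^-1 = proj X' x by rewrite conjgKV.
  apply: (proj_injective (a := X)) => //.
  have <- : proj a (proj X (proj X' x)) = proj X (proj X' x) by rewrite XX'x ?fixP.
  by rewrite -proj_lcomp // aX proj_lcomp // proj_deltaN.
have: w \in P1 by apply: (fintype.subsetP (cobj_cent P1)).
rewrite defP1 => /imsetP[u Pu]; rewrite proj_lcomp // proj_linc // => def_w.
have Qu := sPQ' _ Pu.
move: def_a; rewrite def_w -deltaN_comm // lcompA XX' lcomp1l => def_a.
have Cu : u \in 'C_S(P).
  rewrite inE (fintype.subsetP (cobj_sub P)) //; apply/centP => x Px.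
  apply: commute_sym; apply/commgP/conjg_fixP; suff {1}<- : x ^ u^-1 = x by rewrite conjgKV.
  by rewrite -{2}(fixP x Px) def_a proj_deltaN ?cobj_norm ?sPQ'.
move: aP; rewrite def_a deltaN_linc ?cobj_norm // => /(deltaN_free Cu) ->.
by rewrite deltaN1.
Qed.

Lemma linc_fix_normal P Q (sPQ : P \subset Q) (a : mor L Q Q) :
  P <| Q -> lcomp a (linc L sPQ) = linc L sPQ -> a = lid L Q.
Proof.
move=> nPQ aP; have /andP[sQS cQ] := cobj_centric Q.
(* Conjugate in L by an isomorphism from Q to a fully normalized subgroup. *)
have [Q1 cQQ1 nQ1] := fully_normalized_ex F sQS.
have [f [g [Ff Fg fK gK]]] := fconjP cQQ1.
have [sQ1S _] := fhom_obj Fg.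
have cQ1 : (Q1 \subset S) && centric F Q1 by rewrite sQ1S (fconj_centric cQ).
pose Q0 := CObj cQ1.
have [X [X' [_ _ XX' X'X]]] := fhom_lift_iso L (Q := Q0) Ff Fg fK gK.
have [P1 [sP1 [b [b' [def_b bb' b'b defP1]]]]] := lcomp_iso_linc (lcomp X (linc L sPQ)).
have nP1 : P1 <| Q0.
  apply/andP; split=> //; apply/normsP => y Q0y.
  have Qy := proj_in X' Q0y; have def_y : y = proj X (proj X' y).
    by rewrite -proj_lcomp // XX' proj1.
  apply/eqP; rewrite eqEcard cardJg leqnn andbT.
  apply/fintype.subsetP => z; rewrite defP1 => /imsetP[_ /imsetP[x Px ->] ->].
  rewrite proj_lcomp // proj_linc //.
  have Qx := fintype.subsetP sPQ _ Px.
  apply/imsetP; exists (x ^ proj X' y).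
    by rewrite memJ_norm // (fintype.subsetP (normal_norm nPQ)).
  rewrite proj_lcomp ?memJ_norm ?(fintype.subsetP (normal_norm nPQ)) //.
  rewrite proj_linc ?memJ_norm ?(fintype.subsetP (normal_norm nPQ)) //.
  by rewrite proj_conj ?Qx // -def_y.
suff aX : lcomp X (lcomp a X') = lid L Q0.
  apply: (lcomp_mono (a := X)).
  have: lcomp (lcomp X (lcomp a X')) X = X by rewrite aX lcomp1l.
  by rewrite -!lcompA X'X !lcomp1r.
apply: (linc_fix_fully_normalized (sPQ := sP1) nP1 nQ1).
have -> : linc L sP1 = lcomp (lcomp X (linc L sPQ)) b'.
  by rewrite def_b -lcompA bb' lcomp1r.
by rewrite !lcompA -(lcompA _ X' X) X'X lcomp1r -(lcompA X a) aP.
Qed.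

(** Over the centric subgroup P, the values of two extensions at g in Q differ by
    an element centralizing the image of P.  Hence both have the same image, and
    they differ by an automorphism of Q to which [linc_fix_normal] applies. *)
Lemma linc_epi_normal P Q T (sPQ : P \subset Q) (a b : mor L Q T) :
  P <| Q -> lcomp a (linc L sPQ) = lcomp b (linc L sPQ) -> a = b.
Proof.
move=> nPQ abP; have sPQ' := fintype.subsetP sPQ.
have eqP x : x \in P -> proj a x = proj b x.
  move=> Px; have := proj_lcomp a (linc L sPQ) Px.
  by rewrite abP proj_lcomp // proj_linc.
have [c bc] : exists c, lcomp b c = a.
  apply: lcomp_factor; apply/fintype.subsetP => _ /imsetP[g Qg ->].
  have [P2 defP2] := cobj_im (proj_hom (lcomp b (linc L sPQ))).
  have : proj a g * (proj b g)^-1 \in P2.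
    apply: (fintype.subsetP (cobj_cent P2)); rewrite inE.
    rewrite groupM ?groupV ?(fintype.subsetP (cobj_sub T)) ?proj_in //.
    apply/centP => y; rewrite defP2 => /imsetP[x Px ->].
    rewrite proj_lcomp // proj_linc //.
    apply: commute_sym; apply/commgP/conjg_fixP; have Qx := sPQ' _ Px.
    rewrite conjgM -{1}eqP // -proj_conj // eqP ?proj_conj ?conjgK //.
    by rewrite memJ_norm // (fintype.subsetP (normal_norm nPQ)).
  rewrite defP2 => /imsetP[u Pu]; rewrite proj_lcomp // proj_linc //.
  have Qu := sPQ' _ Pu; move/(canRL (mulgKV _)) => ->.
  by rewrite -(proj_morph b Qu Qg) imset_f // groupM.
rewrite -bc in abP *; rewrite (linc_fix_normal (sPQ := sPQ) (a := c) nPQ) ?lcomp1r //.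
by apply: (lcomp_mono (a := b)); rewrite lcompA.
Qed.

(** Climb from P to Q through normalizers, which grow in the p-group Q. *)
Lemma linc_epi P Q T (sPQ : P \subset Q) (a b : mor L Q T) :
  lcomp a (linc L sPQ) = lcomp b (linc L sPQ) -> a = b.
Proof.
have [k] := ubnP (#|Q| - #|P|)%N.
elim: k P sPQ => // k IHk P sPQ leQPk abP.
have [eqPQ | neqPQ] := eqVneq (P : {set gT}) Q.
  by apply: linc_epi_normal abP; rewrite /normal sPQ eqPQ normG.
have ltPQ : P \proper Q by rewrite properEneq neqPQ.
have nilQ : nilpotent Q by apply: pgroup_nil (pgroupS (cobj_sub Q) pS).
have ltPN := nilpotent_proper_norm nilQ ltPQ.
have sNQ : 'N_Q(P) \subset Q := subsetIl _ _.
have [N defN] := cobj_over (proper_sub ltPN) (fintype.subset_trans sNQ (cobj_sub Q)).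
rewrite -defN in ltPN sNQ; have sPN := proper_sub ltPN.
apply: (IHk N sNQ).
  have := proper_card ltPN; have := subset_leq_card sNQ; lia.
apply: (linc_epi_normal (sPQ := sPN)).
  by rewrite /normal sPN defN subsetIr.
by rewrite -!lcompA lincM.
Qed.

Lemma lcomp_epi P Q T (c : mor L P Q) (a b : mor L Q T) :
  lcomp a c = lcomp b c -> a = b.
Proof.
have [P1 [sP1 [d [d' [-> dd' _ _]]]]] := lcomp_iso_linc c.
rewrite !lcompA => eq_ab; apply: (linc_epi (sPQ := sP1)).
have := congr1 (fun e => lcomp e d') eq_ab.
by rewrite -!(lcompA _ d d') dd' !lcomp1r.
Qed.

End Epi.

(** * Extending an automorphism of a centric subgroup *)

Section Extend.

Variables (p : nat) (gT : finGroupType) (S : {group gT}) (F : fusion_system S).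
Variable L : linking_system F.
Hypotheses (pS : p.-group S) (satF : saturated p F).
Implicit Types (P Q T V : cobj F).

Local Notation dN P g := (laut_mor (deltaN L P g)).

(** All F-conjugates P' of P satisfy C_S(P') = Z(P'), and these are isomorphic. *)
Lemma centric_fully_centralized (P : {group gT}) : P \subset S ->
  centric F P -> fully_centralized F P.
Proof.
move=> sPS cP; apply/forallP => Q; apply/implyP => cPQ.
have [f [g [Ff Fg fK gK]]] := fconjP cPQ.
have sCQ := implyP (forallP cP Q) cPQ.
have [gM ginj gP] := fhom_inj Fg.
have sCQ' := fintype.subsetP sCQ.
rewrite -(card_in_imset (f := g) (D := 'C_S(Q))); last first.
  by move=> x y /sCQ' Qx /sCQ' Qy; apply: ginj.
apply: subset_leq_card; apply/fintype.subsetP => _ /imsetP[x Cx ->].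
have Qx := sCQ' _ Cx; have [_ /centP cQx] := setIP Cx.
rewrite inE (fintype.subsetP sPS) ?gP //; apply/centP => y Py.
have [_ _ fQ] := fhom_inj Ff.
by rewrite -(fK y) // /commute -!gM ?fQ // cQx ?fQ.
Qed.

Lemma N_ext_group_set (P : {group gT}) f : group_set (N_ext S P f).
Proof.
apply/group_setP; split=> [|x y].
  rewrite inE group1; apply/exists_inP; exists 1 => //.
  by apply/forall_inP => z _; rewrite invg1 !conjg1.
rewrite inE => /andP[Nx /exists_inP[x' Nx' /forall_inP fx]].
rewrite inE => /andP[Ny /exists_inP[y' Ny' /forall_inP fy]].
rewrite inE groupM //; apply/exists_inP; exists (x' * y'); first by rewrite groupM.
apply/forall_inP => z Pz; rewrite !invMg !conjgM.
have Pzy : z ^ y^-1 \in P by rewrite memJ_norm // groupV; case/setIP: Ny.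
by rewrite (eqP (fx _ Pzy)) (eqP (fy _ Pz)).
Qed.

Lemma fhom_extend V (N : {group gT}) f : F V S f -> V \subset N ->
  N \subset N_ext S V f -> exists2 h, F N S h & {in V, h =1 f}.
Proof.
move=> Ff sVN sN; have [V' [defV' sV'S Ff' _]] := fhom_im_iso Ff.
have /andP[sVS cV] := cobj_centric V.
have cV' : fully_centralized F V'.
  by apply: centric_fully_centralized => //; rewrite (fconj_centric cV) // (fconj_im Ff).
have [h Fh hf] := satF.2 V V' (Group (N_ext_group_set V f)) f Ff defV' cV' erefl.
by exists h => //; apply: fhom_restrict Fh sN.
Qed.

Lemma laut_mulE P (a b : laut L P) : laut_mor (a * b) = lcomp a b.
Proof. by []. Qed.

Lemma laut_conjP P (a x y : laut L P) :
  x ^ a^-1 = y <-> lcomp a x = lcomp y a.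
Proof.
rewrite -!laut_mulE; split=> [<- | /val_inj E]; first by rewrite conjgE invgK -!mulgA mulVg mulg1.
by rewrite conjgE invgK mulgA E mulgK.
Qed.

Lemma proj_laut_im P (a : laut L P) : proj a @: P = P.
Proof.
apply/eqP; rewrite eqEcard (card_in_imset (proj_injective (a := a))) leqnn andbT.
by apply/fintype.subsetP => _ /imsetP[x Px ->]; apply: proj_in.
Qed.

Lemma deltaN_inj P : {in 'N_S(P) &, injective (deltaN L P)}.
Proof.
move=> x y Nx Ny E; apply/eqP; rewrite eq_mulgV1; apply/eqP.
have Nxy : x * y^-1 \in 'N_S(P) by rewrite groupM ?groupV.
have E1 : deltaN L P (x * y^-1) = 1.
  by rewrite deltaNM ?groupV // deltaNV // E mulgV.
have E2 : dN P (x * y^-1) = lid L P by rewrite E1.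
have Cxy : x * y^-1 \in 'C_S(P).
  have [Sxy _] := setIP Nxy; rewrite inE Sxy; apply/centP => z Pz.
  apply: commute_sym; apply/commgP/conjg_fixP.
  suff {1}<- : z ^ (x * y^-1)^-1 = z by rewrite conjgKV.
  by rewrite -(proj_deltaN L Nxy Pz) E2 proj1.
by apply: (deltaN_free (L := L) (a := lid L P) Cxy); rewrite lcomp1l.
Qed.

(** The hypothesis on a says that Q, hence V Q, lies in N_f for f = proj a; the
    extension of f provided by saturation lifts to L, and its lift can be
    corrected by an element of Z(V) so as to extend a itself. *)
Lemma laut_extend V (a : laut L V) Q : Q \subset 'N_S(V) ->
    {in Q, forall q, exists2 g, g \in 'N_S(V) & deltaN L V q ^ a^-1 = deltaN L V g} ->
  exists (Q' B B' : cobj F) (t : mor L B B') (b : mor L Q Q'),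
    [/\ Q' \subset 'N_S(V) /\ Q' :=: proj b @: Q, B :=: V <*> Q,
        B' :=: V <*> Q', extension a t & extension b t].
Proof.
move=> nVQ aQ; pose f := proj a; have fV : f @: V = V := proj_laut_im a.
have sVS := cobj_sub V.
have Ff : F V S f by apply: fhom_widen (proj_hom a) sVS (fintype.subxx S).
have sBS : V <*> Q \subset S by rewrite join_subG sVS cobj_sub.
have [B defB] := cobj_over (joing_subl V Q) sBS.
have sVB : V \subset B by rewrite defB joing_subl.
have sQB : Q \subset B by rewrite defB joing_subr.
have sBN : B \subset N_ext S V f.
  rewrite defB -[N_ext S V f]/(gval (Group (N_ext_group_set V f))) join_subG.
  apply/andP; split; apply/fintype.subsetP => x.
    move=> Vx; rewrite inE cobj_norm //; apply/exists_inP; exists (f x).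
      by rewrite fV cobj_norm // proj_in.
    apply/forall_inP => y Vy; rewrite /f proj_conj ?groupV //.
    by rewrite -[proj a]/(mfun (Morphism (proj_morph a))) morphV.
  move=> Qx; have Nx := fintype.subsetP nVQ _ Qx; have [g Ng /laut_conjP ag] := aQ x Qx.
  rewrite inE Nx; apply/exists_inP; exists g; rewrite ?fV //.
  apply/forall_inP => y Vy; rewrite /f -(proj_deltaN L Nx Vy) -(proj_deltaN L Ng (proj_in a Vy)).
  by rewrite -!proj_lcomp // ag.
have [h Fh hf] := fhom_extend Ff sVB sBN.
have [B' defB'] := cobj_im Fh.
have sVB' : V \subset B'.
  rewrite -fV defB'; apply/fintype.subsetP => _ /imsetP[x Vx ->].
  by rewrite -hf // imset_f // (fintype.subsetP sVB).
have Fh' : F B B' h.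
  by apply: fhom_codom Fh (cobj_sub B') _ => x Bx; rewrite defB' imset_f.
have [t0 def_t0] := proj_surj L Fh'.
have /proj_eq[z Cz] : {in V, proj (lcomp t0 (linc L sVB)) =1 proj (lcomp (linc L sVB') a)}.
  move=> x Vx; rewrite !proj_lcomp // !proj_linc ?proj_in //.
  by rewrite def_t0 ?(fintype.subsetP sVB) // hf.
have Vz : z \in V := fintype.subsetP (cobj_cent V) _ Cz.
rewrite -lcompA -deltaN_linc ?cobj_norm ?(fintype.subsetP sVB) // lcompA.
have cardB : #|B'| = #|B|.
  by have [_ hinj _] := fhom_inj Fh; rewrite defB' card_in_imset.
move: (lcomp t0 _) => t {h Fh hf defB' Fh' t0 def_t0 Cz Vz z} ext_a.
have imB : proj t @: B = B'.
  apply/eqP; rewrite eqEcard (card_in_imset (proj_injective (a := t))) cardB leqnn andbT.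
  by apply/fintype.subsetP => _ /imsetP[x Bx ->]; apply: proj_in.
have ta x : x \in V -> proj t x = f x.
  move=> Vx; have := proj_lcomp t (linc L sVB) Vx.
  by rewrite -ext_a proj_lcomp // !proj_linc ?proj_in.
have [Q' defQ'] := cobj_im (fhom_restrict (proj_hom t) sQB).
have sQB' : Q' \subset B'.
  rewrite defQ' -imB; apply: imsetS; exact: sQB.
have nVQ' : Q' \subset 'N_S(V).
  rewrite subsetI cobj_sub; apply/fintype.subsetP => y.
  rewrite defQ' => /imsetP[q Qq ->]; rewrite inE.
  have Bq := fintype.subsetP sQB _ Qq.
  apply/fintype.subsetP => _ /imsetP[z Vz ->].
  move: Vz; rewrite -{1}fV => /imsetP[x Vx ->]; rewrite -ta //.
  have Bx := fintype.subsetP sVB _ Vx.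
  have Vxq : x ^ q \in V.
    by rewrite memJ_norm //; have /setIP[] := fintype.subsetP nVQ _ Qq.
  by rewrite -proj_conj // ta // -fV imset_f.
have [|b def_b] := lcomp_restrict (a := t) sQB sQB'.
  by move=> x Qx; rewrite defQ' imset_f.
have tb q : q \in Q -> proj b q = proj t q.
  move=> Qq; have := proj_lcomp t (linc L sQB) Qq.
  by rewrite -def_b proj_lcomp // !proj_linc ?proj_in.
exists Q', B, B', t, b; split=> //; last 2 first.
- by exists sVB, sVB'.
- by exists sQB, sQB'.
- by split=> //; rewrite defQ'; apply: eq_in_imset => q /tb ->.
suff sB' : B' \subset V <*> Q' by apply/eqP; rewrite eqEsubset sB' join_subG sVB'.
rewrite -imB.
apply/fintype.subsetP => _ /imsetP[x Bx ->].
have nVQ2 : Q \subset 'N(V) := fintype.subset_trans nVQ (subsetIr _ _).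
move: Bx; rewrite defB /= (norm_joinEr nVQ2).
case/mulsgP => y q Vy Qq ->.
rewrite proj_morph ?(fintype.subsetP sVB y) ?(fintype.subsetP sQB q) // ta //.
apply: groupM; first by apply: (fintype.subsetP (joing_subl _ _)); rewrite -fV imset_f.
by apply: (fintype.subsetP (joing_subr _ _)); rewrite defQ' imset_f.
Qed.
End Extend.

(** * The restrictions of the extended automorphisms *)

Section Hat.

Variables (p : nat) (gT : finGroupType) (S : {group gT}) (F : fusion_system S).
Variable L : linking_system F.
Hypotheses (pS : p.-group S) (satF : saturated p F).
Variables (n : nat) (R : 'I_n -> cobj F).
Implicit Types (P Q T V : cobj F) (v : option 'I_n).

Local Notation dN P g := (laut_mor (deltaN L P g)).
Local Notation A v := (laut L (vertex R v)).

(** In L, conjugation by the extension t of a and b is conjugation by proj t on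
    delta(B); it is read off on V through the monomorphism V -> B'. *)
Lemma extension_conj V Q Q' B B' (a : laut L V) (t : mor L B B') (b : mor L Q Q') :
    Q \subset 'N_S(V) -> Q' \subset 'N_S(V) -> extension a t -> extension b t ->
  {in Q, forall q, deltaN L V q ^ a^-1 = deltaN L V (proj b q)}.
Proof.
move=> nVQ nVQ' [sVB [sVB' at_]] [sQB [sQB' bt]] q Qq.
rewrite -!/(linc _ _) in at_ bt.
have Q'b : proj b q \in Q' by apply: proj_in.
have Bq := fintype.subsetP sQB _ Qq; have Bb := fintype.subsetP sQB' _ Q'b.
have tb : proj b q = proj t q.
  have := proj_lcomp t (linc L sQB) Qq.
  by rewrite -bt proj_lcomp // !proj_linc ?proj_in.
have Nq := fintype.subsetP nVQ _ Qq; have Nb := fintype.subsetP nVQ' _ Q'b.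
apply/laut_conjP; apply: (lcomp_mono (a := linc L sVB')).
rewrite lcompA at_ -lcompA -(deltaN_linc L sVB Nq (cobj_norm Bq)) lcompA deltaN_comm // -tb.
by rewrite -lcompA -at_ !lcompA (deltaN_linc L sVB' Nb (cobj_norm Bb)).
Qed.

Lemma hat_conj v (a : A v) Q Q' (b : mor L Q Q') : hat a b ->
  {in Q, forall q, deltaN L (vertex R v) q ^ a^-1 = deltaN L (vertex R v) (proj b q)}.
Proof.
by case=> nQ nQ' _ [B [B' [t [_ _ at_ bt]]]]; apply: extension_conj at_ bt.
Qed.

Lemma hat_im v (a : A v) Q Q' (b : mor L Q Q') : hat a b -> Q' :=: proj b @: Q.
Proof.
move=> ab; have [nQ nQ' im _] := ab.
apply/setP => y; apply/idP/imsetP => [Q'y | [q Qq ->]]; last exact: proj_in.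
have: deltaN L (vertex R v) y \in deltaN L (vertex R v) @: Q' by apply: imset_f.
rewrite -im => /imsetP[_ /imsetP[q Qq ->]]; rewrite (hat_conj ab) // => /deltaN_inj E.
exists q => //; apply: E; first exact: (fintype.subsetP nQ').
by apply: (fintype.subsetP nQ'); apply: proj_in.
Qed.

Lemma hat_exists v (a : A v) Q : Q \subset 'N_S(vertex R v) ->
    {in Q, forall q, exists2 g, g \in 'N_S(vertex R v) &
       deltaN L (vertex R v) q ^ a^-1 = deltaN L (vertex R v) g} ->
  exists Q' (b : mor L Q Q'), hat a b.
Proof.
move=> nQ /(laut_extend satF nQ)[Q' [B [B' [t [b [[nQ' imb] defB defB' at_ bt]]]]]].
exists Q', b; split=> //; last by exists B, B', t.
have ab := extension_conj nQ nQ' at_ bt; rewrite imb.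
apply/setP => y; apply/imsetP/imsetP => [] [_ /imsetP[q Qq ->] ->].
  by exists (proj b q); rewrite ?imset_f // ab.
by exists (deltaN L (vertex R v) q); rewrite ?imset_f ?ab.
Qed.

(** Q1 is determined since delta is injective on N_S(R_v), and the extension t of
    a since R_v -> R_v Q is an epimorphism. *)
Lemma hat_tagged v (a : A v) Q Q1 Q2 (b1 : mor L Q Q1) (b2 : mor L Q Q2) :
  hat a b1 -> hat a b2 -> Tagged (mor L Q) b1 = Tagged (mor L Q) b2.
Proof.
move=> [nQ nQ1 im1 [B [B1 [t1 [defB defB1 at1 bt1]]]]].
move=> [_ nQ2 im2 [B0 [B2 [t2 [defB0 defB2 at2 bt2]]]]].
have eqQ : Q1 = Q2.
  have eqim : deltaN L (vertex R v) @: Q1 = deltaN L (vertex R v) @: Q2 by rewrite -im1.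
  have sub (T T' : cobj F) : T \subset 'N_S(vertex R v) -> T' \subset 'N_S(vertex R v) ->
     deltaN L (vertex R v) @: T = deltaN L (vertex R v) @: T' -> T \subset T'.
    move=> nT nT' E; apply/fintype.subsetP => x Tx.
    have : deltaN L (vertex R v) x \in deltaN L (vertex R v) @: T' by rewrite -E imset_f.
    case/imsetP=> y T'y /deltaN_inj -> //.
      exact: (fintype.subsetP nT).
    exact: (fintype.subsetP nT').
  by apply: cobj_eq; apply/eqP; rewrite eqEsubset !sub.
have eqB0 : B0 = B by apply: cobj_eq; rewrite defB0 defB.
subst Q2 B0; have eqB2 : B2 = B1 by apply: cobj_eq; rewrite defB2 defB1.
subst B2; move: at1 at2 bt1 bt2 => [sVB [sVB1 at1]] [sVB' [sVB1' at2]] [sQB [sQB1 bt1]] [sQB' [sQB1' bt2]].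
rewrite -!/(linc _ _) in at1 at2 bt1 bt2.
rewrite (bool_irrelevance sVB1' sVB1) (bool_irrelevance sVB' sVB) at1 in at2.
rewrite (bool_irrelevance sQB1' sQB1) (bool_irrelevance sQB' sQB) in bt2.
move/(linc_epi pS satF): at2 => at2; congr Tagged.
by apply: (lcomp_mono (a := linc L sQB1)); rewrite bt1 bt2 at2.
Qed.

(** Dually to [hat_tagged], t is determined by b since Q -> R_v Q is an
    epimorphism. *)
Lemma hat_free v (a a' : A v) Q Q' (b : mor L Q Q') :
  hat a b -> hat a' b -> a = a'.
Proof.
move=> [nQ nQ1 im1 [B [B1 [t1 [defB defB1 at1 bt1]]]]].
move=> [_ _ im2 [B0 [B2 [t2 [defB0 defB2 at2 bt2]]]]].
have eqB0 : B0 = B by apply: cobj_eq; rewrite defB0 defB.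
have eqB2 : B2 = B1 by apply: cobj_eq; rewrite defB2 defB1.
subst B0 B2; move: at1 at2 bt1 bt2 => [sVB [sVB1 at1]] [sVB' [sVB1' at2]] [sQB [sQB1 bt1]] [sQB' [sQB1' bt2]].
rewrite -!/(linc _ _) in at1 at2 bt1 bt2.
rewrite (bool_irrelevance sVB1' sVB1) (bool_irrelevance sVB' sVB) in at2.
rewrite (bool_irrelevance sQB1' sQB1) (bool_irrelevance sQB' sQB) bt1 in bt2.
move/(linc_epi pS satF): bt2 => bt2; apply: val_inj.
by apply: (lcomp_mono (a := linc L sVB1)); rewrite at1 at2 bt2.
Qed.

Lemma hat_comp v (a a' : A v) Q Q' Q'' (b : mor L Q Q') (b' : mor L Q' Q'') :
  hat a b -> hat a' b' -> hat (a' * a) (lcomp b' b).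
Proof.
move=> [nQ nQ1 im1 [B [B1 [t1 [defB defB1 at1 bt1]]]]].
move=> [_ nQ2 im2 [B0 [B2 [t2 [defB0 defB2 at2 bt2]]]]].
split=> //; first by rewrite invMg conjsgM im1.
have eqB0 : B0 = B1 by apply: cobj_eq; rewrite defB0 defB1.
subst B0; exists B, B2, (lcomp t2 t1); split=> //.
  move: at1 at2 => [sVB [sVB1 at1]] [sVB' [sVB1' at2]]; exists sVB, sVB1'.
  rewrite (bool_irrelevance sVB' sVB1) in at2.
  by rewrite /= lcompA at2 -lcompA at1 lcompA.
move: bt1 bt2 => [sQB [sQB1 bt1]] [sQB' [sQB1' bt2]]; exists sQB, sQB1'.
rewrite (bool_irrelevance sQB' sQB1) in bt2.
by rewrite lcompA bt2 -lcompA bt1 lcompA.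
Qed.

Lemma conj_deltaN V s x : s \in 'N_S(V) -> x \in 'N_S(V) ->
  deltaN L V x ^ (deltaN L V s)^-1 = deltaN L V (x ^ s^-1).
Proof.
move=> Ns Nx.
by rewrite !conjgE !invgK !deltaNM ?groupM ?groupV // deltaNV.
Qed.

Lemma hat_delta v Q Q' (u : trans Q Q') :
    Q \subset 'N_S(vertex R v) -> sval u \in 'N_S(vertex R v) ->
    Q' :=: Q :^ (sval u)^-1 ->
  hat (deltaN L (vertex R v) (sval u)) (delta L u).
Proof.
case: u => s Ns' /=; set V := vertex R v => nQ Ns defQ'.
have nQ' : Q' \subset 'N_S(V) by rewrite defQ' -(conjGid (groupVr Ns)) conjSg.
split=> //.
  rewrite defQ'; apply/setP => y; apply/imsetP/imsetP.
    case=> _ /imsetP[x Qx ->] ->; exists (x ^ s^-1); first by rewrite memJ_conjg.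
    by rewrite conj_deltaN // (fintype.subsetP nQ).
  case=> _ /imsetP[x Qx ->] ->; exists (deltaN L V x); first exact: imset_f.
  by rewrite conj_deltaN // (fintype.subsetP nQ).
have [B defB] : exists B : cobj F, B :=: V <*> Q.
  by apply: cobj_over (joing_subl _ _) _; rewrite join_subG !cobj_sub.
have [B' defB'] : exists B : cobj F, B :=: V <*> Q'.
  by apply: cobj_over (joing_subl _ _) _; rewrite join_subG !cobj_sub.
have nVs : V :^ s^-1 = V by apply/normP; rewrite groupV; case/setIP: Ns.
have NB : s \in transp B B'.
  rewrite inE; have [-> _] := setIP Ns; rewrite defB defB' conjYg nVs defQ'.
  exact: fintype.subxx.
have NV : s \in transp V V by rewrite transpN.
have [sVB sVB'] : V \subset B /\ V \subset B' by rewrite defB defB' !joing_subl.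
have [sQB sQB'] : Q \subset B /\ Q' \subset B' by rewrite defB defB' !joing_subr.
exists B, B', (delta L (Trans NB)); split=> //.
  exists sVB, sVB'; rewrite (deltaNE L NV).
  have NVB : s \in transp V B'.
    move: NV; rewrite !inE => /andP[-> sV] /=; exact: fintype.subset_trans sV _.
  by rewrite -!(@deltaM _ _ _ _ _ _ _ _ _ (Trans NVB)) //= ?mulg1 ?mul1g.
exists sQB, sQB'.
have NQB : s \in transp Q B'.
  move: Ns'; rewrite !inE => /andP[-> sV] /=; exact: fintype.subset_trans sV _.
by rewrite -!(@deltaM _ _ _ _ _ _ _ _ _ (Trans NQB)) //= ?mulg1 ?mul1g.
Qed.

Lemma hat1 v Q : Q \subset 'N_S(vertex R v) -> hat (1 : A v) (lid L Q).
Proof.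
move=> nQ; have := @hat_delta v Q Q (tincl (fintype.subxx Q)) nQ (group1 _).
by rewrite /= deltaN1 invg1 conjsg1 (delta1 L) //; apply.
Qed.

Lemma hat_inv v (a : A v) Q Q' (b : mor L Q Q') : hat a b ->
  exists b', [/\ hat a^-1 b', lcomp b' b = lid L Q & lcomp b b' = lid L Q'].
Proof.
move=> ab; have [nQ nQ' im _] := ab.
have [||Q2 [b' ab']] := @hat_exists v a^-1 Q' => //.
  move=> y Q'y; have : deltaN L (vertex R v) y \in deltaN L (vertex R v) @: Q'.
    exact: imset_f.
  rewrite -im => /imsetP[_ /imsetP[q Qq ->] ->]; rewrite conjgK.
  by exists q; rewrite ?(fintype.subsetP nQ).
have := hat_comp ab ab'; rewrite mulVg => /hat_tagged/(_ (hat1 nQ)) E.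
have eqQ : Q2 = Q := congr1 (fun u => tag u) E; subst Q2.
have b'b : lcomp b' b = lid L Q by move/eqP: E; rewrite eq_Tagged => /eqP.
exists b'; split=> //; apply: (lcomp_epi pS satF (c := b)).
by rewrite -lcompA b'b lcomp1l lcomp1r.
Qed.

Lemma hat_restrict v (a : A v) Q Q' (b : mor L Q Q') P (sPQ : P \subset Q) : hat a b ->
  exists P' (sP' : P' \subset Q') (c : mor L P P'),
    hat a c /\ lcomp (linc L sP') c = lcomp b (linc L sPQ).
Proof.
move=> ab; have [nQ nQ' _ [B [B' [t [defB defB' at_ bt]]]]] := ab.
have nP := fintype.subset_trans sPQ nQ; have sPQ' := fintype.subsetP sPQ.
have [|P' [c ac]] := @hat_exists v a P nP.
  move=> q Pq; exists (proj b q); last by rewrite (hat_conj ab) ?sPQ'.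
  by apply: (fintype.subsetP nQ'); rewrite proj_in ?sPQ'.
have [_ nP' _ [B1 [B1' [t1 [defB1 defB1' at1 ct1]]]]] := ac.
have bc q : q \in P -> proj c q = proj b q.
  move=> Pq; have := hat_conj ac Pq; rewrite (hat_conj ab (sPQ' _ Pq)).
  move/deltaN_inj => -> //; last by apply: (fintype.subsetP nP'); rewrite proj_in.
  by apply: (fintype.subsetP nQ'); rewrite proj_in ?sPQ'.
have sP' : P' \subset Q'.
  rewrite (hat_im ac); apply/fintype.subsetP => _ /imsetP[q Pq ->].
  by rewrite bc // proj_in ?sPQ'.
exists P', sP', c; split=> //.
move: at_ bt at1 ct1 => [sVB [sVB' at_]] [sQB [sQB' bt]] [sVB1 [sVB1' at1]] [sPB1 [sPB1' ct1]].
rewrite -!/(linc _ _) in at_ bt at1 ct1.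
have sB1 : B1 \subset B by rewrite defB1 defB genS // setUS.
have sB1' : B1' \subset B' by rewrite defB1' defB' genS // setUS.
have tt1 : lcomp t (linc L sB1) = lcomp (linc L sB1') t1.
  apply: (linc_epi pS satF (sPQ := sVB1)).
  by rewrite -!lcompA -at1 lincM -at_ lcompA lincM.
apply: (lcomp_mono (a := linc L sQB')); rewrite !lcompA bt.
have sPB := fintype.subset_trans sPQ sQB.
have sPB' := fintype.subset_trans sP' sQB'.
rewrite (lincM L sP' sQB' sPB') -(lincM L sPB1' sB1' sPB') -lcompA ct1 lcompA -tt1.
by rewrite -!lcompA (lincM L sPB1 sB1 sPB) (lincM L sPQ sQB sPB).
Qed.

End Hat.

(** * Completing free partial actions *)

Section FreeExtension.

Variables (Y : finType) (kT : finGroupType) (K : {group kT}).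
Variables b1 b2 : kT -> {perm Y}.
Hypothesis b1M : {in K &, {morph b1 : x y / x * y}}.
Hypothesis b2M : {in K &, {morph b2 : x y / x * y}}.
Hypothesis b1_free : forall x y, x \in K -> b1 x y = y -> x = 1.
Hypothesis b2_free : forall x y, x \in K -> b2 x y = y -> x = 1.

(** Both D and its image are unions of regular orbits; match the remaining orbits
    one at a time. *)
Lemma free_equivariant_extension (D : {set Y}) (f : Y -> Y) :
    (forall x y, x \in K -> y \in D -> b1 x y \in D) ->
    {in D &, injective f} ->
    (forall x y, x \in K -> y \in D -> f (b1 x y) = b2 x (f y)) ->
  exists2 h : {perm Y}, {in D, h =1 f} &
    {in K, forall x, b1 x * h = h * b2 x}.
Proof.
have b11 : b1 1 = 1 by apply: (mulgI (b1 1)); rewrite -b1M ?group1 // !mulg1.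
have b21 : b2 1 = 1 by apply: (mulgI (b2 1)); rewrite -b2M ?group1 // !mulg1.
have [k] := ubnP #|~: D|; elim: k D f => // k IHk D f leDk stD injf eqf.
have [/setP DT | [y Dy]] := set_0Vmem (~: D).
  have inD y : y \in D by have := DT y; rewrite !inE => /negbFE.
  have injf' : injective f by move=> y z; apply: injf.
  exists (perm injf') => [y _ | x Kx]; first by rewrite permE.
  by apply/permP => y; rewrite !permM !permE eqf.
rewrite inE in Dy; pose E := f @: D.
have stE x z : x \in K -> z \in E -> b2 x z \in E.
  by move=> Kx /imsetP[u Du ->]; rewrite -eqf // imset_f // stD.
have [z Ez] : exists z, z \notin E.
  apply/existsP; rewrite -negb_forall; apply/negP => /forallP inE_.
  have : #|D| < #|Y|.
    by rewrite -cardsT; apply: proper_card; apply/properP; split=> //; exists y.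
  rewrite -(card_in_imset injf) -/E (_ : E = setT) ?cardsT ?ltnn //.
  by apply/setP => u; rewrite inE_ inE.
(* Send the orbit O of y equivariantly to the orbit of z. *)
pose O := [set b1 x y | x in K].
pose g u := if u \in D then f u else
  if [pick x in K | b1 x y == u] is Some x then b2 x z else u.
have gO x : x \in K -> g (b1 x y) = b2 x z.
  move=> Kx; rewrite /g ifN; last first.
    apply: contra Dy => Dxy; have := stD x^-1 _ (groupVr Kx) Dxy.
    by rewrite -permM -b1M ?groupV // mulgV b11 perm1.
  case: pickP => [w /andP[Kw /eqP Ew] | /(_ x)]; last by rewrite Kx eqxx.
  suff -> : w = x by [].
  apply/eqP; rewrite eq_mulgV1; apply/eqP; apply: (b1_free (y := y)).
    by rewrite groupM ?groupV.
  by rewrite b1M ?groupV // permM Ew -permM -b1M ?groupV // mulgV b11 perm1.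
have gD u : u \in D -> g u = f u by rewrite /g => ->.
have OND x : x \in K -> b1 x y \notin D.
  move=> Kx; apply: contra Dy => Dxy; have := stD x^-1 _ (groupVr Kx) Dxy.
  by rewrite -permM -b1M ?groupV // mulgV b11 perm1.
have zNE x : x \in K -> b2 x z \notin E.
  move=> Kx; apply: contra Ez => Exy; have := stE x^-1 _ (groupVr Kx) Exy.
  by rewrite -permM -b2M ?groupV // mulgV b21 perm1.
have [||||h hg heq] := IHk (D :|: O) g.
- rewrite -ltnS; apply: leq_trans leDk; rewrite ltnS; apply: proper_card.
  apply/properP; split; first by rewrite setCS subsetUl.
  exists y; rewrite !inE ?negbK ?Dy //; apply/orP; right.
  by apply/imsetP; exists 1; rewrite ?group1 // b11 perm1.
- move=> x u Kx; rewrite !inE => /orP[Du | /imsetP[w Kw ->]]; first by rewrite stD.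
  apply/orP; right; apply/imsetP; exists (w * x); first exact: groupM.
  by rewrite b1M // permM.
- move=> u v; rewrite !inE => /orP[Du | /imsetP[w Kw ->]] /orP[Dv | /imsetP[t Kt ->]].
  + by rewrite !gD //; apply: injf.
  + rewrite (gD u) // gO // => E1; have := zNE t Kt.
    by rewrite -E1 imset_f.
  + rewrite (gD v) // gO // => E1; have := zNE w Kw.
    by rewrite E1 imset_f.
  + rewrite !gO // => E1; suff -> : w = t by [].
    apply/eqP; rewrite eq_mulgV1; apply/eqP; apply: (b2_free (y := z)).
      by rewrite groupM ?groupV.
    by rewrite b2M ?groupV // permM E1 -permM -b2M ?groupV // mulgV b21 perm1.
- move=> x u Kx; rewrite !inE => /orP[Du | /imsetP[w Kw ->]].
    by rewrite !gD ?stD // eqf.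
  by rewrite -permM -b1M // !gO ?groupM // b2M // permM.
exists h => // u Du; rewrite hg ?gD //; by rewrite inE Du.
Qed.

End FreeExtension.

(** A family of groups A v with common subgroups: N v embeds in A v and, as a
    subgroup of N o, in A o.  [r a m m'] reads: the partial action of a sends m
    to m'. *)
Section PartialActions.

Variables (V : finType) (o : V) (A : V -> finGroupType).
Variables (kT : finGroupType) (N : V -> {group kT}) (u : forall v, kT -> A v).
Variables (M : finType) (r : forall v, A v -> M -> M -> Prop).
Hypothesis uM : forall v, {in N v &, {morph u v : x y / x * y}}.
Hypothesis u_inj : forall v, {in N v &, injective (u v)}.
Hypothesis sNo : forall v, N v \subset N o.
Hypothesis rM : forall v (a a' : A v) m m' m'',
  r a m m' -> r a' m' m'' -> r (a' * a) m m''.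
Hypothesis rV : forall v (a : A v) m m', r a m m' -> r a^-1 m' m.
Hypothesis r_fun : forall v (a : A v) m m1 m2, r a m m1 -> r a m m2 -> m1 = m2.
Hypothesis r_free : forall v (a a' : A v) m m', r a m m' -> r a' m m' -> a = a'.
Hypothesis r_total : forall (a : A o) m, exists m', r a m m'.
Hypothesis r_edge : forall v (a : A v) s m m', r a m m' -> s \in N v ->
  exists2 m1, r (u v s) m m1 & r (u o s) m m1.

Let H := {dffun forall v, A v}.
Let Y := (M * H)%type.

Let dom v m := `[< exists a : A v, exists m', r a m m' >].

(** A canonical point of the partial orbit of m: it depends only on the orbit,
    because [pick] only depends on the extension of its predicate. *)
Let rep v m := [pick m' | `[< exists a : A v, r a m' m >]].
Let lab v m := [pick a : A v | if rep v m is Some m' then `[< r a m' m >] else false].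

Let lmul v (a : A v) (y : Y) : Y := (y.1, (dfung1 a : H) * y.2).

Let labP v m : dom v m -> exists m' a, [/\ rep v m = Some m', lab v m = Some a & r a m' m].
Proof.
move=> /asboolP[a [m' am]]; rewrite /lab /rep.
case: pickP => [m1 /asboolP[b bm] | /(_ m') /asboolP[]]; last by exists a^-1; apply: rV.
case: pickP => [c /asboolP cm | /(_ b) /asboolP[] //].
by exists m1, c.
Qed.

(** All groups A v act freely on M * H, each through its own factor of H.  Sending
    m to (rep m, lab m) embeds the domain of the v-th partial action into the
    v-th of these actions. *)
Let emb v m : Y :=
  (odflt m (rep v m), dfung1 (odflt 1 (lab v m)) : H).

Let rep_r v (a : A v) m m' : r a m m' -> rep v m = rep v m'.
Proof.
move=> am; apply: eq_pick => x; apply/asboolP/asboolP => -[b bx].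
  by exists (a * b); apply: rM bx am.
by exists (a^-1 * b); apply: rM bx (rV am).
Qed.

Let emb_act v (a : A v) m m' : r a m m' -> emb v m' = lmul a (emb v m).
Proof.
move=> am; have [|m0 [c [rm lm cm]]] := @labP v m.
  by apply/asboolP; exists a, m'.
have [|m1 [c' [rm' lm' cm']]] := @labP v m'.
  by apply/asboolP; exists a^-1, m; apply: rV.
have E := rep_r am; rewrite rm rm' in E; case: E => E; subst m1.
have def_c' : c' = a * c by apply: r_free cm' _; apply: rM cm am.
by rewrite /emb /lmul rm rm' lm lm' /= def_c' dfung1_morphM.
Qed.

Let emb_inj v m1 m2 : dom v m1 -> dom v m2 -> emb v m1 = emb v m2 -> m1 = m2.
Proof.
move=> /labP[m0 [c [rm lm cm]]] /labP[m0' [c' [rm' lm' cm']]].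
rewrite /emb rm rm' lm lm' /= => -[E /(congr1 (fun h : H => h v))].
rewrite !dfung1_id => E'; rewrite -E -E' in cm'; exact: r_fun cm cm'.
Qed.

Let dom_o m : dom o m.
Proof. by have [m' am] := r_total 1 m; apply/asboolP; exists 1, m'. Qed.

Let lmulM v (a b : A v) y : lmul (a * b) y = lmul a (lmul b y).
Proof. by rewrite /lmul /= dfung1_morphM mulgA. Qed.

Let lmul1 v y : lmul (1 : A v) y = y.
Proof. have d1 : dfung1 (1 : A v) = 1 :> H.
  by apply: (mulgI (dfung1 (1 : A v) : H)); rewrite -dfung1_morphM !mulg1.
by rewrite /lmul d1 mul1g; case: y. Qed.

Let lmul_inj v (a : A v) : injective (lmul a).
Proof. by apply: (can_inj (g := lmul a^-1)) => y; rewrite -lmulM mulVg lmul1. Qed.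

Let lact v (a : A v) : {perm Y} := perm (@lmul_inj v a^-1).

Let lactM v : {morph @lact v : a b / a * b}.
Proof. by move=> a b; apply/permP => y; rewrite permM !permE invMg lmulM. Qed.

Let lact_free v (a : A v) y : lact a y = y -> a = 1.
Proof.
rewrite permE => /(congr1 (fun y => y.2)) /= /(canRL (mulgK _)).
rewrite mulgV => /(congr1 (fun h : H => h v)); rewrite dfung1_id oneg_ffun.
by move/(congr1 invg); rewrite invgK invg1.
Qed.

Let lact_emb v (a : A v) m m' : r a m m' -> lact a (emb v m') = emb v m.
Proof. by move=> /rV /emb_act; rewrite permE. Qed.

(** The actions on M * H have to be glued.  Only the embedding for o is used to
    view M inside M * H; the action of A v is transported by a bijection that
    carries this embedding to the one for v and is N v-equivariant, hence agrees
    with the action of A o on N v.  Permutations are multiplied from left to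
    right, so that f v a is the inverse of the action of a. *)
Theorem partial_amalgam_action : exists (Z : finType) (e : M -> Z)
    (f : forall v, A v -> {perm Z}),
  [/\ injective e, forall v, {morph f v : a b / a * b},
      forall v, {in N v, forall s, f v (u v s) = f o (u o s)}
    & forall v (a : A v) m m', r a m m' -> f v a (e m') = e m].
Proof.
have e_inj : injective (emb o) by move=> m m'; apply: emb_inj.
have u1 v : u v 1 = 1.
  by apply: (mulgI (u v 1)); rewrite -uM ?group1 // !mulg1.
have uV v s : s \in N v -> u v s^-1 = (u v s)^-1.
  by move=> Ns; apply: (mulgI (u v s)); rewrite -uM ?groupV // !mulgV u1.
have sN v s : s \in N v -> s \in N o by apply: (fintype.subsetP (sNo v)).
have /choice[h hP] : forall v, exists h : {perm Y},
    (forall m, dom v m -> h (emb o m) = emb v m) /\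
    {in N v, forall s, lact (u o s) * h = h * lact (u v s)}.
  move=> v; pose D := emb o @: [set m | dom v m].
  pose f y := if [pick m | dom v m && (emb o m == y)] is Some m then emb v m else y.
  have fE m : dom v m -> f (emb o m) = emb v m.
    rewrite /f => dm; case: pickP => [m' /andP[_ /eqP/e_inj-> //] | /(_ m)].
    by rewrite dm eqxx.
  have edge s m : s \in N v -> dom v m -> exists m1, [/\ dom v m1,
      lact (u o s) (emb o m) = emb o m1 & lact (u v s) (emb v m) = emb v m1].
    move=> Ns /asboolP[a [m' am]].
    have [m1 m1v m1o] := r_edge am (groupVr Ns); exists m1; split.
    - by apply/asboolP; exists (u v s^-1)^-1, m; apply: rV.
    - by apply: lact_emb; rewrite -[u o s]invgK -(uV o) ?(sN v) //; apply: rV.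
    - by apply: lact_emb; rewrite -[u v s]invgK -(uV v) //; apply: rV.
  have [|||||||h hf hN] := @free_equivariant_extension Y kT (N v)
    (fun s => lact (u o s)) (fun s => lact (u v s)) _ _ _ _ D f.
  - by move=> s t Ns Nt; rewrite /= uM ?(sN v) // lactM.
  - by move=> s t Ns Nt; rewrite /= uM // lactM.
  - by move=> s y Ns /lact_free; rewrite -(u1 o); apply: u_inj; rewrite ?group1 ?(sN v).
  - by move=> s y Ns /lact_free; rewrite -(u1 v); apply: u_inj; rewrite ?group1.
  - move=> s y Ns /imsetP[m]; rewrite inE => /(edge s _ Ns)[m1 [dm1 E _]] ->.
    by rewrite E imset_f // inE.
  - move=> _ _ /imsetP[m dm ->] /imsetP[m' dm' ->]; rewrite !inE in dm dm'.
    by rewrite !fE // => /emb_inj->.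
  - move=> s y Ns /imsetP[m]; rewrite inE => dm ->.
    by have [m1 [dm1 E1 E2]] := edge s m Ns dm; rewrite E1 !fE.
  exists h; split=> // m dm; rewrite hf ?fE //.
  by rewrite imset_f // inE.
(* For v = o the bijection h o need not be 1, but it commutes with N o. *)
pose f v (a : A v) := h v * lact a * (h v)^-1.
have fu v s : s \in N v -> f v (u v s) = lact (u o s).
  by move=> Ns; rewrite /f -(hP v).2 // mulgK.
exists Y, (emb o), f; split=> // [v a b | v s Ns | v a m m' am].
- by rewrite /f lactM !mulgA mulgKV.
- by rewrite !fu ?(sN v).
have [dm dm'] : dom v m /\ dom v m'.
  by split; apply/asboolP; [exists a, m' | exists a^-1, m; apply: rV].
by rewrite !permM (hP v).1 // (lact_emb am) -(hP v).1 // permK.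
Qed.

End PartialActions.

(** * Words in the amalgam and their composites *)

Section Words.

Variables (p : nat) (gT : finGroupType) (S : {group gT}) (F : fusion_system S).
Variable L : linking_system F.
Hypotheses (pS : p.-group S) (satF : saturated p F).
Variables (n : nat) (R : 'I_n -> cobj F).
Variables (G : groupType) (iota : forall v, laut L (vertex R v) -> G).
Hypothesis amalG : robinson_amalgam iota.
Implicit Types (P Q T V : cobj F) (v : option 'I_n) (g : G).

Local Notation A v := (laut L (vertex R v)).
Local Notation i := (robinson_emb iota).

Let iotaM v : {morph iota (v := v) : a b / a * b}.
Proof. exact: amalG.1.1. Qed.

Lemma iota1 v : iota (1 : A v) = 1.
Proof. by apply: (mulgI (iota (1 : A v))); rewrite -iotaM !mulg1. Qed.

Lemma iotaV v (a : A v) : iota a^-1 = (iota a)^-1.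
Proof. by apply: (mulgI (iota a)); rewrite -iotaM !mulgV iota1. Qed.

Lemma norm_top : 'N_S(S) = S.
Proof. by apply/setIidPl; apply: normG. Qed.

Lemma iota_deltaN v s : s \in 'N_S(vertex R v) -> iota (deltaN L (vertex R v) s) = i s.
Proof. by case: v => [j|] // /amalG.1.2. Qed.

(** Aut_L(S) acts totally: it normalizes delta_S(S). *)
Lemma hat_top (a : A None) Q : exists Q' (b : mor L Q Q'), hat a b.
Proof.
apply: (hat_exists satF); first by rewrite norm_top cobj_sub.
move=> q Qq; have Sq : q \in top_cobj F := fintype.subsetP (cobj_sub Q) _ Qq.
exists (proj a q); first by rewrite cobj_norm // proj_in.
by apply/laut_conjP; apply: deltaN_comm.
Qed.

Lemma hat_word_comp P Q T g g' (c : mor L P Q) (c' : mor L Q T) :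
  hat_word iota g c -> hat_word iota g' c' -> hat_word iota (g' * g) (lcomp c' c).
Proof.
move=> gc; elim=> [|Q1 Q2 v a b h d ab _ IH]; first by rewrite mul1g lcomp1l.
by rewrite -mulgA -lcompA; apply: hat_cons.
Qed.

Lemma hat_word1 v (a : A v) P Q (b : mor L P Q) :
  hat a b -> hat_word iota (iota a) b.
Proof.
by move=> ab; rewrite -[iota a]mulg1 -[b]lcomp1r; apply: hat_cons ab (hat_nil _ _).
Qed.

Lemma hat_word_inv P Q g (c : mor L P Q) : hat_word iota g c ->
  exists c', [/\ hat_word iota g^-1 c', lcomp c' c = lid L P & lcomp c c' = lid L Q].
Proof.
elim=> [|Q1 Q2 v a b h d ab _ [d' [hd' d'd dd']]].
  by exists (lid L P); rewrite invg1 lcomp1l; split=> //; apply: hat_nil.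
have [b' [ab' b'b bb']] := hat_inv pS satF ab; exists (lcomp d' b'); split.
- by rewrite invMg -iotaV; apply: hat_word_comp hd'; apply: hat_word1.
- by rewrite -lcompA (lcompA b') b'b lcomp1l.
- by rewrite -lcompA (lcompA d) dd' lcomp1l.
Qed.

Lemma hat_word_conj P Q g (c : mor L P Q) : hat_word iota g c ->
  {in P, forall x, g * i x * g^-1 = i (proj c x)}.
Proof.
elim=> [|Q1 Q2 v a b h d ab hd IH] x Px; first by rewrite invg1 mulg1 mul1g proj1.
rewrite invMg !mulgA -(mulgA (iota a)) -(mulgA (iota a)) IH // proj_lcomp //.
have [nQ1 nQ2 _ _] := ab; have Qd := proj_in d Px.
rewrite -(iota_deltaN (v := v)) ?(fintype.subsetP nQ1) //.
rewrite -(iota_deltaN (v := v)) ?(fintype.subsetP nQ2) ?proj_in //.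
by rewrite -iotaV -!iotaM -(hat_conj ab) // conjgE invgK mulgA.
Qed.

Lemma hat_word_delta P x : x \in P -> hat_word iota (i x) (deltaN L P x).
Proof.
move=> Px; have Sx := fintype.subsetP (cobj_sub P) _ Px.
have Nx : x \in transp P P by rewrite transpN cobj_norm.
rewrite (deltaNE L Nx); apply: hat_word1.
apply: (hat_delta L (v := None) (u := Trans Nx)); rewrite ?norm_top ?cobj_sub //=.
by rewrite conjGid ?groupV.
Qed.

Lemma hat_word_restrict P Q g (c : mor L P Q) : hat_word iota g c ->
  forall T (sTP : T \subset P), exists T' (sTQ : T' \subset Q) (d : mor L T T'),
    hat_word iota g d /\ lcomp (linc L sTQ) d = lcomp c (linc L sTP).
Proof.
elim=> [|Q1 Q2 v a b h d ab _ IH] T sTP.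
  exists T, sTP, (lid L T); split; first exact: hat_nil.
  by rewrite lcomp1l lcomp1r.
have [T1 [sT1 [e [he ed]]]] := IH T sTP.
have [T2 [sT2 [f [af fb]]]] := hat_restrict pS satF sT1 ab.
exists T2, sT2, (lcomp f e); split; first exact: hat_cons.
by rewrite lcompA fb -lcompA ed lcompA.
Qed.

(** Words from P act on the set M of all morphisms with source P, by composition;
    see [partial_amalgam_action]. *)
Lemma hat_word_tagged P g Q Q' (c : mor L P Q) (c' : mor L P Q') :
  hat_word iota g c -> hat_word iota g c' -> Tagged (mor L P) c = Tagged (mor L P) c'.
Proof.
pose M : finType := {Q : cobj F & mor L P Q}.
pose r v (a : A v) (m m' : M) := exists2 b : mor L (tag m) (tag m'),
  hat a b & tagged m' = lcomp b (tagged m).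
have [] := @partial_amalgam_action _ None (fun v => laut L (vertex R v)) gT
  (fun v => 'N_S(vertex R v)%G) (fun v => deltaN L (vertex R v)) M r.
- by move=> v; apply: deltaNM.
- by move=> v; apply: deltaN_inj.
- by move=> v; apply: fintype.subset_trans (subsetIl _ _) _; rewrite /= norm_top.
- move=> v a a' [Q1 m1] [Q2 m2] [Q3 m3] [b /= ab ->] [b' /= ab' ->].
  by exists (lcomp b' b); [apply: hat_comp ab ab' | rewrite lcompA].
- move=> v a [Q1 m1] [Q2 m2] [b /= ab ->].
  have [b' [ab' b'b _]] := hat_inv pS satF ab.
  by exists b' => //=; rewrite lcompA b'b lcomp1l.
- move=> v a [Q1 m1] [Q2 m2] [Q3 m3] [b /= ab ->] [b' /= ab' ->].
  have := hat_tagged pS satF ab ab'.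
  by move/(congr1 (fun w => Tagged (mor L P) (lcomp (tagged w) m1))).
- move=> v a a' [Q1 m1] [Q2 m2] [b /= ab ->] [b' /= ab' /(lcomp_epi pS satF) E].
  by subst b'; exact: (hat_free pS satF ab ab').
- move=> a [Q1 m1]; have [Q2 [b ab]] := hat_top a Q1.
  by exists (Tagged (mor L P) (lcomp b m1)); exists b.
- move=> v a s [Q1 m1] [Q2 m2] [b /= [nQ1 _ _ _] _] Ns.
  have Ss : s \in S by case/setIP: Ns.
  have [Q3 defQ3] : exists Q3 : cobj F, Q3 :=: Q1 :^ s^-1.
    have Fs : F Q1 S (conjg^~ s^-1).
      apply: fhom_conj; rewrite ?cobj_sub //.
      by rewrite sub_conjgV conjGid // cobj_sub.
    by have [Q3 defQ3] := cobj_im Fs; exists Q3.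
  have Nss : s \in transp Q1 Q3 by rewrite inE Ss defQ3 fintype.subxx.
  exists (Tagged (mor L P) (lcomp (delta L (Trans Nss)) m1)).
    by exists (delta L (Trans Nss)) => //=; apply: (hat_delta L (u := Trans Nss)).
  exists (delta L (Trans Nss)) => //=.
  by apply: (hat_delta L (v := None) (u := Trans Nss)); rewrite //= norm_top ?cobj_sub.
move=> Z [e [f [e_inj fM fN fr]]] gc gc'.
have coc : cocone f.
  by split=> // j s Ns; rewrite (fN (Some j)).
have [h hf _] := amalG.2 _ _ coc.
have h1 : h 1 = 1 by apply: (mulgI (h 1)); rewrite -gmulfM !mulg1.
have he Q0 g0 (c0 : mor L P Q0) : hat_word iota g0 c0 ->
    h g0 (e (Tagged (mor L P) c0)) = e (Tagged (mor L P) (lid L P)).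
  elim=> [|Q1 Q2 v a b h0 d ab _ IH]; first by rewrite h1 perm1.
  rewrite gmulfM permM hf (fr v a (Tagged (mor L P) d)) //.
  by exists b.
by apply: e_inj; apply: (perm_inj (s := h g)); rewrite !he.
Qed.

Lemma hat_word_inj P Q g (c c' : mor L P Q) :
  hat_word iota g c -> hat_word iota g c' -> c = c'.
Proof.
by move=> gc gc'; have /eqP := hat_word_tagged gc gc'; rewrite eq_Tagged => /eqP.
Qed.

(** a has the word a of composite a from R_v to itself, so if iota a = 1 then a is
    also the composite of the empty word. *)
Lemma iota_inj v : injective (iota (v := v)).
Proof.
move=> a a' eq_a; apply/eqP; rewrite eq_mulgV1; apply/eqP; set b := _ * _.
have ib : iota b = 1 by rewrite /b iotaM iotaV eq_a mulgV.
have hb : hat b (laut_mor b).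
  have nV : vertex R v \subset 'N_S(vertex R v) by apply/fintype.subsetP=> x; apply: cobj_norm.
  have sVV := fintype.subxx (vertex R v).
  have ext_b : extension (laut_mor b) (laut_mor b).
    by exists sVV, sVV; rewrite -!/(linc _ _) !linc1 lcomp1l lcomp1r.
  have bV := extension_conj nV nV ext_b ext_b.
  split=> //.
    rewrite -[in RHS](proj_laut_im b); apply/setP => y; apply/imsetP/imsetP => [] [_ /imsetP[q Qq ->] ->].
      by exists (proj b q); rewrite ?imset_f // bV.
    by exists (deltaN L (vertex R v) q); rewrite ?imset_f ?bV.
  exists (vertex R v), (vertex R v), b.
  by rewrite (joing_idPl sVV); split.
apply: val_inj; have := hat_word1 hb; rewrite ib => E.
exact: hat_word_inj E (hat_nil _ _).
Qed.

End Words.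

(** * Cocycles on the amalgam *)

Section CocycleGroup.

Variables (G : groupType) (U : zmodType).

(** The semidirect product of G with the right G-module Fun(G, U); a section
    g |-> (g, c g) is multiplicative exactly when c is a cocycle. *)
Definition cocycle_ext : Type := G * (G -> U).

HB.instance Definition _ := gen_eqMixin cocycle_ext.
HB.instance Definition _ := gen_choiceMixin cocycle_ext.

Definition cocycle_mul (a b : cocycle_ext) : cocycle_ext :=
  (a.1 * b.1, fun y => (b.2 y + a.2 (b.1 * y)%g)%R).
Definition cocycle_one : cocycle_ext := (1, fun=> 0%R).
Definition cocycle_inv (a : cocycle_ext) : cocycle_ext :=
  (a.1^-1, fun y => (- a.2 (a.1^-1 * y)%g)%R).

Lemma cocycle_mulA : associative cocycle_mul.
Proof.
move=> a b c; congr pair => /=; first exact: mulgA.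
by apply/funext => y; rewrite GRing.addrA mulgA.
Qed.

Lemma cocycle_mul1 : left_id cocycle_one cocycle_mul.
Proof.
move=> [a f]; congr pair => /=; first exact: mul1g.
by apply/funext => y; rewrite GRing.addr0.
Qed.

Lemma cocycle_mulr1 : right_id cocycle_one cocycle_mul.
Proof.
move=> [a f]; congr pair => /=; first exact: mulg1.
by apply/funext => y; rewrite mul1g GRing.add0r.
Qed.

Lemma cocycle_mulV : left_inverse cocycle_one cocycle_inv cocycle_mul.
Proof.
move=> [a f]; congr pair => /=; first exact: mulVg.
by apply/funext => y; rewrite mulKg GRing.addrN.
Qed.

Lemma cocycle_mulrV : right_inverse cocycle_one cocycle_inv cocycle_mul.
Proof.
move=> [a f]; congr pair => /=; first exact: mulgV.
by apply/funext => y; rewrite GRing.addNr.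
Qed.

HB.instance Definition _ := isGroup.Build cocycle_ext
  cocycle_mulA cocycle_mul1 cocycle_mulr1 cocycle_mulV cocycle_mulrV.

End CocycleGroup.

Section Cocycles.

Variables (gT : finGroupType) (S : {group gT}) (F : fusion_system S).
Variable L : linking_system F.
Variables (n : nat) (R : 'I_n -> cobj F).
Variables (G : groupType) (iota : forall v, laut L (vertex R v) -> G).
Hypothesis amalG : robinson_amalgam iota.

Lemma amalgam_hom_unique (H : groupType) (f f' : G -> H) :
    {morph f : x y / x * y} -> {morph f' : x y / x * y} ->
  (forall v a, f (iota (v := v) a) = f' (iota a)) -> f =1 f'.
Proof.
move=> fM f'M eqf; have [[iM iN] univ] := amalG.
have coc : cocone (fun v a => f (iota (v := v) a)).
  split=> [v a b | j s Ns]; first by rewrite iM fM.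
  by rewrite (iN j).
have [h _ h_uniq] := univ _ _ coc.
pose Mf := isMultiplicative.Build G H f fM.
pose Mf' := isMultiplicative.Build G H f' f'M.
pose hf : {multiplicative G -> H} := HB.pack f Mf.
pose hf' : {multiplicative G -> H} := HB.pack f' Mf'.
by move=> x; rewrite -[f x]/(hf x) -[f' x]/(hf' x) !h_uniq //=.
Qed.

(** c g y stands for the integral of a weight along the path from the vertex
    A_None y to the vertex A_None g y. *)
Definition cocycle (U : zmodType) (c : G -> G -> U) :=
  forall g h y, c (g * h)%g y = (c h y + c g (h * y)%g)%R.

Lemma cocycle_unique (U : zmodType) (c c' : G -> G -> U) :
    cocycle c -> cocycle c' ->
    (forall v (a : laut L (vertex R v)) y, c (iota a) y = c' (iota a) y) ->
  c = c'.
Proof.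
move=> cM c'M eqc; have E : (fun g => (g, c g) : cocycle_ext G U) =1 (fun g => (g, c' g)).
  apply: amalgam_hom_unique => [g h | g h | v a].
  - by congr pair; apply/funext => y; rewrite cM.
  - by congr pair; apply/funext => y; rewrite c'M.
  - by congr pair; apply/funext => y.
by apply/funext => g; have [] := E g.
Qed.

(** When phi None = 0, the weight of the edge N_j y is phi (Some j) y: the path
    for a in Aut_L(R_j) goes from A_None y through the edge N_j y to A_j y, and on
    through the edge N_j a y to A_None a y. *)
Lemma cocycle_ex (U : zmodType) (phi : option 'I_n -> G -> U) :
    (forall j s y, s \in 'N_S(R j) ->
       phi None (robinson_emb iota s * y) = phi None y /\
       phi (Some j) (robinson_emb iota s * y) = phi (Some j) y) ->
  exists2 c : G -> G -> U, cocycle c &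
    forall v (a : laut L (vertex R v)) y,
      c (iota a) y = (phi v y - phi v (iota a * y)%g)%R.
Proof.
move=> phiN; have [[iM iN] univ] := amalG.
pose f v (a : laut L (vertex R v)) : cocycle_ext G U :=
  (iota a, fun y => phi v y - phi v (iota a * y)%g)%R.
have coc : cocone f.
  split=> [v a b | j s Ns].
    congr pair => /=; first by rewrite iM.
    apply/funext => y; rewrite GRing.addrA GRing.subrK iM.
    by rewrite mulgA.
  rewrite /f -(iN j) //; congr pair; apply/funext => y.
  by have [-> ->] := phiN j s y Ns; rewrite !GRing.subrr.
have [h hf _] := univ _ _ coc.
have h1 : (fun g => (h g).1) =1 id.
  apply: amalgam_hom_unique => [g g' | g g' | v a] //; first by rewrite gmulfM.
  by rewrite hf.
exists (fun g => (h g).2) => [g g' y | v a y]; last by rewrite hf.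
by rewrite gmulfM /= h1.
Qed.

End Cocycles.

(** * Every transporting element is a word *)

Section Existence.

Variables (p : nat) (gT : finGroupType) (S : {group gT}) (F : fusion_system S).
Variable L : linking_system F.
Hypotheses (p_pr : prime p) (pS : p.-group S) (satF : saturated p F).
Variables (n : nat) (R : 'I_n -> cobj F).
Variables (G : groupType) (iota : forall v, laut L (vertex R v) -> G).
Hypothesis amalG : robinson_amalgam iota.
Implicit Types (Q T V : cobj F) (v : option 'I_n) (g : G).

Local Notation A v := (laut L (vertex R v)).
Local Notation i := (robinson_emb iota).

Hypothesis i_inj : {in S &, injective i}.

Let iotaM v : {morph iota (v := v) : a b / a * b}.
Proof. exact: amalG.1.1. Qed.

Lemma embM : {in S &, {morph i : x y / x * y}}.
Proof.
by move=> x y Sx Sy; rewrite /robinson_emb deltaNM ?norm_top ?iotaM.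
Qed.

Lemma emb1 : i 1 = 1.
Proof. by rewrite /robinson_emb deltaN1 iota1. Qed.

Lemma embV : {in S, {morph i : x / x^-1}}.
Proof.
by move=> x Sx; apply: (mulgI (i x)); rewrite -embM ?groupV // !mulgV emb1.
Qed.

Variable P : cobj F.

Let SP x : x \in P -> x \in S.
Proof. exact: (fintype.subsetP (cobj_sub P)). Qed.

Let SN v s : s \in 'N_S(vertex R v) -> s \in S.
Proof. by case/setIP. Qed.

(** The vertex A_v g of the tree lies in the part swept out by words starting at
    P. *)
Definition reached v g : Prop := exists (a : A v) h Q (c : mor L P Q),
  [/\ g = iota a * h, hat_word iota h c & Q \subset 'N_S(vertex R v)].

Lemma reached_top g : reached None g <->
  exists Q (c : mor L P Q), hat_word iota g c.
Proof.
split=> [[a [h [Q [c [-> hc _]]]]] | [Q [c gc]]].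
  have [Q' [b ab]] := hat_top satF a Q.
  by exists Q', (lcomp b c); apply: hat_cons.
exists 1, g, Q, c; split=> //; first by rewrite (iota1 amalG) mul1g.
by rewrite norm_top cobj_sub.
Qed.

Lemma reached_iota v (a : A v) g : reached v (iota a * g) <-> reached v g.
Proof.
split=> -[b [h [Q [c [def_g hc nQ]]]]].
  exists (a^-1 * b), h, Q, c; split=> //.
  by rewrite iotaM (iotaV amalG) -mulgA -def_g mulKg.
by exists (a * b), h, Q, c; split=> //; rewrite iotaM def_g mulgA.
Qed.

Lemma reached_mulP v g x : x \in P -> reached v (g * i x) <-> reached v g.
Proof.
have step y h : y \in P -> reached v h -> reached v (h * i y).
  move=> Py [b [k [Q [c [-> hc nQ]]]]].
  exists b, (k * i y), Q, (lcomp c (deltaN L P y)); split=> //.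
    by rewrite mulgA.
  exact: hat_word_comp (hat_word_delta iota Py) hc.
move=> Px; split=> [|]; last exact: step.
by move/(step x^-1); rewrite embV ?SP // mulgK; apply; rewrite groupV.
Qed.

(** The boundary of the reached part, as a signed function on edges: 1 if the edge
    N_v g has its end A_None g inside and its end A_v g outside, -1 in the
    opposite case. *)
Definition defect v g : int := (`[<reached None g>]%:R - `[<reached v g>]%:R)%R.

(** The stabilizer in P of the edge N_v g. *)
Definition edge_stab v g : {set gT} :=
  [set x in P | `[< exists2 s, s \in 'N_S(vertex R v) & g * i x = i s * g >]].

Lemma edge_stabP v g x : reflect (x \in P /\
   exists2 s, s \in 'N_S(vertex R v) & g * i x = i s * g) (x \in edge_stab v g).
Proof.
rewrite inE; apply: (iffP andP) => -[Px]; first by move/asboolP.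
by move=> H; split=> //; apply/asboolP.
Qed.

Lemma edge_stab_group_set v g : group_set (edge_stab v g).
Proof.
apply/group_setP; split=> [|x y].
  by apply/edge_stabP; split=> //; exists 1 => //; rewrite emb1 mulg1 mul1g.
move=> /edge_stabP[Px [s Ns sx]] /edge_stabP[Py [t Nt ty]]; apply/edge_stabP; split.
  exact: groupM.
exists (s * t); first exact: groupM.
rewrite (embM (SP Px) (SP Py)) (embM (SN Ns) (SN Nt)).
by rewrite mulgA sx -mulgA ty mulgA.
Qed.

Lemma reached_of_edge_fixed v g : edge_stab v g = P -> reached None g -> reached v g.
Proof.
move=> stP /reached_top[Q [c gc]].
exists 1, g, Q, c; split=> //; first by rewrite (iota1 amalG) mul1g.
have [c' [_ c'c cc']] := hat_word_inv pS satF amalG gc.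
apply/fintype.subsetP => y Qy; pose x := proj c' y.
have Px : x \in P by apply: proj_in.
have def_y : y = proj c x by rewrite /x -proj_lcomp // cc' proj1.
have : x \in edge_stab v g by rewrite stP.
case/edge_stabP=> _ [s Ns /(canLR (mulgK _))].
rewrite (hat_word_conj amalG gc Px) -def_y.
by move/i_inj=> -> //; [exact: (fintype.subsetP (cobj_sub Q)) | exact: SN Ns].
Qed.

(** The vertex A_v g is reached, say g = a h with h P h^-1 = Q.  That P fixes the
    edge means that a conjugates Q into N_S(R_v), first in G and then in
    Aut_L(R_v) by injectivity of iota; so the word of h can be prolonged by a. *)
Lemma reached_top_of_edge_fixed v g : edge_stab v g = P -> reached v g -> reached None g.
Proof.
move=> stP [a [h [Q [c [def_g hc nQ]]]]].
have [c' [_ c'c cc']] := hat_word_inv pS satF amalG hc.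
have [|Q' [b ab]] := hat_exists satF (a := a) nQ.
  move=> y Qy; pose x := proj c' y.
  have Px : x \in P by apply: proj_in.
  have def_y : y = proj c x by rewrite /x -proj_lcomp // cc' proj1.
  have : x \in edge_stab v g by rewrite stP.
  case/edge_stabP=> _ [s Ns /(canLR (mulgK _))]; rewrite def_g invMg !mulgA.
  rewrite -(mulgA (iota a)) -(mulgA (iota a)) (hat_word_conj amalG hc Px) -def_y.
  have Ny := fintype.subsetP nQ _ Qy.
  rewrite -(iota_deltaN amalG Ny) -(iota_deltaN amalG Ns) -(iotaV amalG) -!iotaM.
  move/(iota_inj pS satF amalG) => E; exists s => //.
  by rewrite conjgE invgK mulgA.
by apply/reached_top; exists Q', (lcomp b c); rewrite def_g; apply: hat_cons.
Qed.

Lemma edge_stab_proper v g : defect v g != 0%R -> edge_stab v g \proper P.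
Proof.
move=> d_neq0; rewrite properEneq; apply/andP; split; last first.
  by apply/fintype.subsetP => x /edge_stabP[].
apply: contra d_neq0 => /eqP stP.
rewrite /defect; have -> : `[<reached None g>] = `[<reached v g>].
  by apply/asboolP/asboolP; [apply: reached_of_edge_fixed | apply: reached_top_of_edge_fixed].
by rewrite GRing.subrr eqxx.
Qed.

(** An edge that leaves the reached part has a proper stabilizer in P. *)
Lemma dvdn_edge_stab v g : defect v g != 0%R -> (#|edge_stab v g| %| #|P| %/ p)%N.
Proof.
move/edge_stab_proper; rewrite -[edge_stab v g]/(gval (Group (edge_stab_group_set v g))).
set H := Group _ => ltHP; have sHP := proper_sub ltHP.
have pP : p.-group P := pgroupS (cobj_sub P) pS.
have pdiv : p %| #|P : H|.
  have [k Ek] := p_natP (pnat_dvd (dvdn_indexg P H) pP).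
  case: k Ek => [/eqP|k ->]; last by rewrite expnS dvdn_mulr.
  by rewrite expn0 indexg_eq1 (negPf (proper_subn ltHP)).
by rewrite -(Lagrange sHP) -(divnK pdiv) mulnA mulnK ?prime_gt0 // dvdn_mulr.
Qed.

(** The union N_v g P of the P-orbit of the edge N_v g. *)
Definition double_coset v g : set G := fun h =>
  exists s, exists x, [/\ s \in 'N_S(vertex R v), x \in P & h = i s * g * i x].

Definition dcrep v g : G := xget 1 (double_coset v g).

Lemma dcrepP v g : double_coset v g (dcrep v g).
Proof.
by apply: xgetPex; exists g, 1, 1; rewrite !group1 emb1 mul1g mulg1.
Qed.

Lemma dcrep_eq v g s x : s \in 'N_S(vertex R v) -> x \in P ->
  dcrep v (i s * g * i x) = dcrep v g.
Proof.
move=> Ns Px; congr xget; apply/funext => h; apply/propext.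
have [Ss Sx] := (SN Ns, SP Px).
split=> -[t [y [Nt Py ->]]]; have [St Sy] := (SN Nt, SP Py).
  exists (t * s), (x * y); split; try exact: groupM.
  by rewrite (embM St Ss) (embM Sx Sy) !mulgA.
exists (t * s^-1), (x^-1 * y); split; try by rewrite groupM ?groupV.
rewrite embM ?groupV // embM ?groupV // !embV // !mulgA.
by rewrite mulgKV mulgK.
Qed.

Lemma defect_edge v g s x : s \in 'N_S(vertex R v) -> x \in P ->
  defect v (i s * g * i x) = defect v g.
Proof.
move=> Ns Px; rewrite /defect; congr (_%:R - _%:R)%R; congr (nat_of_bool _).
  apply/asboolP/asboolP; rewrite reached_mulP //; last by rewrite reached_iota.
  by rewrite reached_iota.
by apply/asboolP/asboolP; rewrite reached_mulP // -(iota_deltaN amalG Ns) reached_iota.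
Qed.

(** The defect concentrated on one edge in each P-orbit, and weighted so that the
    sum over x in P is the defect times |P|/p, whatever the orbit; it is integral
    by [dvdn_edge_stab]. *)
Definition edge_weight v g : int :=
  if `[< exists2 s, s \in 'N_S(vertex R v) & g = i s * dcrep v g >] then
    (defect v g *+ ((#|P| %/ p) %/ #|edge_stab v (dcrep v g)|))%R
  else 0%R.

Lemma edge_weight_mul v s g : s \in 'N_S(vertex R v) -> edge_weight v (i s * g) = edge_weight v g.
Proof.
move=> Ns; rewrite -[i s * g]mulg1 -emb1 /edge_weight dcrep_eq // defect_edge //.
rewrite (_ : `[< exists2 _, _ & i s * g * _ = _ >] =
   `[< exists2 s, s \in 'N_S(vertex R v) & g = i s * dcrep v g >]) //.
rewrite emb1 mulg1; apply/asboolP/asboolP => -[t Nt Et].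
  exists (s^-1 * t); first by rewrite groupM ?groupV.
  have [Ss St] := (SN Ns, SN Nt).
  by rewrite embM ?groupV // embV // -mulgA -Et mulKg.
exists (s * t); first exact: groupM.
by have [Ss St] := (SN Ns, SN Nt); rewrite embM // {1}Et mulgA.
Qed.

Lemma sum_edge_weight v g :
  (\sum_(x in P) edge_weight v (g * i x)%g = defect v g *+ (#|P| %/ p))%R.
Proof.
have [d0 | d_neq0] := eqVneq (defect v g) 0%R.
  rewrite d0 GRing.mul0rn; apply: big1 => x Px; rewrite /edge_weight.
  have := defect_edge g (group1 'N_S(vertex R v)) Px.
  by rewrite emb1 mul1g d0 => ->; rewrite GRing.mul0rn if_same.
set q := dcrep v g; have [s0 [x0 [Ns0 Px0 def_q]]] := dcrepP v g.
rewrite -/q in def_q.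
have dq : defect v q = defect v g by rewrite def_q defect_edge.
have := @dvdn_edge_stab v q; rewrite dq => /(_ d_neq0) dvd_q.
pose B := [set x in P | `[< exists2 s, s \in 'N_S(vertex R v) & g * i x = i s * q >]].
have -> : (\sum_(x in P) edge_weight v (g * i x)%g =
           \sum_(x in B) (defect v g *+ ((#|P| %/ p) %/ #|edge_stab v q|)))%R.
  rewrite [RHS]big_mkcond [LHS]big_mkcond; apply: eq_bigr => x _; rewrite inE.
  case: ifP => //= Px; rewrite /edge_weight.
  have := defect_edge g (group1 'N_S(vertex R v)) Px.
  have := dcrep_eq g (group1 'N_S(vertex R v)) Px.
  by rewrite emb1 mul1g => -> ->.
rewrite GRing.sumr_const -GRing.mulrnA.
suff -> : B = x0 *: edge_stab v q by rewrite card_lcoset divnK.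
have [Ss0 Sx0] := (SN Ns0, SP Px0).
apply/setP => x; rewrite mem_lcoset inE.
apply/andP/edge_stabP => -[Px]; last first.
  case=> s Ns E; have Px' : x \in P by rewrite -(mulKVg x0 x) groupM.
  split=> //; apply/asboolP; exists (s0^-1 * s); first by rewrite groupM ?groupV.
  have [Ss Sx] := (SN Ns, SP Px'); move: E; rewrite embM ?groupV // {1}def_q.
  by rewrite !embM ?groupV // !embV // -!mulgA mulKVg => <-; rewrite mulKg.
move=> /asboolP[s Ns E]; split; first by rewrite groupM ?groupV.
exists (s0 * s); first exact: groupM.
have [Ss Sx] := (SN Ns, SP Px); rewrite {1}def_q !embM ?groupV // embV //.
by rewrite -!mulgA mulKVg E.
Qed.

(** If no edge leaves the reached part then being reached is invariant under each
    Aut_L(R_v), hence under G. *)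
Lemma reached_of_defect0 : (forall v g, defect v g = 0%R) -> forall g, reached None g.
Proof.
move=> d0 g; pose c h y : int := (`[<reached None y>]%:R - `[<reached None (h * y)>]%:R)%R.
have c0 : c = fun _ _ => 0%R.
  apply: (cocycle_unique amalG) => [h k y | h k y | v a y].
  - by rewrite /c mulgA GRing.addrA GRing.subrK.
  - by rewrite GRing.addr0.
  have /eqP := d0 v y; have /eqP := d0 v (iota a * y); rewrite /defect /c.
  rewrite (_ : `[<reached v (iota a * y)>] = `[<reached v y>]).
    by rewrite !GRing.subr_eq0 => /eqP -> /eqP ->; rewrite GRing.subrr.
  by apply/asboolP/asboolP; rewrite reached_iota.
have := congr1 (fun f => f g 1) c0; rewrite /c mulg1.
have r1 : reached None 1 by apply/reached_top; exists P, (lid L P); apply: hat_nil.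
by rewrite (asboolT r1); case: asboolP.
Qed.

(** Let c be the cocycle with weight [edge_weight].  Its sum over the translates by
    x in P has weight |P|/p times the boundary of the reached part, so it
    integrates from 1 to g to |P|/p if A_None g is not reached, and to 0
    otherwise.  On the other hand the paths from A_None x = A_None to
    A_None g x = A_None g have the same integral for all x in P, so that sum is
    also |P| c g 1; but |P| does not divide |P|/p. *)
Theorem hat_word_of_conj g :
  (forall x, x \in P -> exists2 s, s \in S & g * i x = i s * g) ->
  exists Q (c : mor L P Q), hat_word iota g c.
Proof.
move=> gP; apply/reached_top.
(* For P = 1 the number |P|/p is 0, but then P fixes every edge. *)
have [P1 | ntP] := eqVneq (P : {set gT}) 1.
  apply: reached_of_defect0 => v h; apply/eqP; apply: contraT => /edge_stab_proper.
  case/properP => _ [x Px /negP[]]; move: Px; rewrite P1 => /set1gP ->.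
  exact: group1 (Group (edge_stab_group_set v h)).
have pP : p %| #|P|.
  have [k oP] := p_natP (pgroupS (cobj_sub P) pS : p.-nat #|P|).
  rewrite oP; case: k oP => [/eqP | k _]; last by rewrite expnS dvdn_mulr.
  by rewrite expn0 -trivg_card1 (negPf ntP).
have [j s y Ns | c cM cE] := cocycle_ex amalG (phi := edge_weight).
  have Ns0 : s \in 'N_S(vertex R None) by rewrite norm_top (SN (v := Some j)).
  by rewrite !edge_weight_mul.
pose c1 h y := (\sum_(x in P) c h (y * i x)%g)%R.
pose c2 h y : int := ((`[<reached None y>]%:R - `[<reached None (h * y)>]%:R) *+ (#|P| %/ p))%R.
(* c2 is the coboundary whose value is the integral of the boundary of the
   reached part, scaled by |P|/p; by uniqueness c1 equals it. *)
have c12 : c1 = c2.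
  apply: (cocycle_unique amalG) => [h k y | h k y | v a y].
  - by rewrite /c1 -big_split /=; apply: eq_bigr => x _; rewrite cM mulgA.
  - by rewrite /c2 -GRing.mulrnDl mulgA; congr (_ *+ _)%R; rewrite GRing.addrA GRing.subrK.
  rewrite /c1 /c2 (eq_bigr (fun x => edge_weight v (y * i x)%g - edge_weight v (iota a * y * i x)%g)%R).
    rewrite GRing.sumrB !sum_edge_weight -GRing.mulrnBl; congr (_ *+ _)%R.
    rewrite /defect (_ : `[<reached v (iota a * y)>] = `[<reached v y>]).
      by rewrite GRing.opprB GRing.addrA GRing.subrK.
    by apply/asboolP/asboolP; rewrite reached_iota.
  by move=> x _; rewrite cE mulgA.
(* Elements of S fix the vertex A_None, and g x = s g with s in S. *)
have c_const x : x \in P -> c g (i x) = c g 1.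
  move=> Px; have [s Ss E] := gP x Px.
  have c0 t y : t \in S -> c (i t) y = 0%R.
    by move=> St; rewrite /robinson_emb cE edge_weight_mul ?norm_top // GRing.subrr.
  have := cM g (i x) 1; rewrite mulg1 c0 ?SP // GRing.add0r => <-.
  by rewrite E cM mulg1 c0 // GRing.addr0.
have := congr1 (fun f => f g 1) c12; rewrite /c1 /c2 mulg1.
rewrite (eq_bigr (fun=> c g 1)); last by move=> x Px; rewrite mul1g c_const.
rewrite GRing.sumr_const.
have r1 : reached None 1 by apply/reached_top; exists P, (lid L P); apply: hat_nil.
rewrite (asboolT r1); case: asboolP => // _.
rewrite -{1}(divnK pP) mulnC GRing.mulrnA GRing.subr0.
have m_gt0 : (0 < #|P| %/ p)%N by rewrite divn_gt0 ?prime_gt0 // dvdn_leq.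
move/(Num.Theory.pmulrnI m_gt0); rewrite -(GRing.mulr_natr (c g 1)) natz.
move/(congr1 absz); rewrite abszM absz_nat => /eqP; rewrite muln_eq1 => /andP[_ /eqP p1].
by have := prime_gt1 p_pr; rewrite p1.
Qed.

End Existence.

(** * The signalizer functor *)

Section Signalizer.

Variables (p : nat) (gT : finGroupType) (S : {group gT}) (F : fusion_system S).
Variable L : linking_system F.
Hypotheses (p_pr : prime p) (pS : p.-group S) (satF : saturated p F).
Variables (n : nat) (R : 'I_n -> cobj F).
Variables (G : groupType) (iota : forall v, laut L (vertex R v) -> G).
Hypothesis amalG : robinson_amalgam iota.
Implicit Types (P Q : cobj F) (g : G).

Local Notation i := (robinson_emb iota).

Hypothesis i_inj : {in S &, injective i}.

Let sub P x : x \in P -> x \in S.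
Proof. exact: (fintype.subsetP (cobj_sub P)). Qed.

Lemma hat_word_im P Q g (c : mor L P Q) : hat_word iota g c -> Q :=: proj c @: P.
Proof.
move=> gc; have [c' [_ _ cc']] := hat_word_inv pS satF amalG gc.
apply/setP => y; apply/idP/imsetP => [Qy | [x Px ->]]; last exact: proj_in.
by exists (proj c' y); rewrite ?proj_in // -proj_lcomp // cc' proj1.
Qed.

Lemma hat_word_transport P (Q : {set gT}) g : (lconj g (img i P) `<=` img i Q)%classic -> Q \subset S ->
  exists P' (c : mor L P P'), hat_word iota g c /\ P' \subset Q.
Proof.
move=> gPQ sQS.
have gP x : x \in P -> exists2 s, s \in Q & g * i x * g^-1 = i s.
  move=> Px; have [|s /= Qs E] := gPQ (g * i x * g^-1); last by exists s.
  by exists (i x) => //; exists x.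
have [|P' [c gc]] := hat_word_of_conj p_pr pS satF amalG i_inj (P := P) (g := g).
  move=> x Px; have [s Qs E] := gP x Px.
  by exists s; rewrite ?(fintype.subsetP sQS) // -E mulgKV.
exists P', c; split=> //; rewrite (hat_word_im gc).
apply/fintype.subsetP => _ /imsetP[x Px ->].
have [s Qs] := gP x Px; rewrite (hat_word_conj amalG gc Px) => /i_inj -> //.
  exact: sub (proj_in c Px).
exact: (fintype.subsetP sQS).
Qed.

Lemma hat_word_end P P' g (c : mor L P P') : hat_word iota g c -> P' \subset P -> P' = P.
Proof.
move=> gc sP'P; apply: cobj_eq; apply/eqP; rewrite eqEcard sP'P (hat_word_im gc).
by rewrite (card_in_imset (proj_injective (a := c))) leqnn.
Qed.

Lemma psi_hat_word P g (c : laut L P) : hat_word iota g c -> psi iota P g = c.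
Proof.
move=> gc; apply: xget_unique => // c' /= gc'.
by apply: val_inj; apply: (hat_word_inj pS satF amalG gc' gc).
Qed.

Lemma ThetaP P g : Theta iota P g <-> hat_word iota g (lid L P).
Proof.
split=> [[nPg psi1] | g1].
  have [|P' [c [gc sP'P]]] := @hat_word_transport P P g _ (cobj_sub P).
    by rewrite nPg.
  have eqP := hat_word_end gc sP'P; subst P'.
  have [c' [_ c'c cc']] := hat_word_inv pS satF amalG gc.
  have c_iso : is_iso c by apply/existsP; exists c'; rewrite c'c cc' !eqxx.
  by have := @psi_hat_word P g (LAut c_iso) gc; rewrite psi1 => /(congr1 val) /= ->.
have gx x : x \in P -> g * i x * g^-1 = i x.
  by move=> Px; rewrite (hat_word_conj amalG g1 Px) proj1.
split; last exact: (@psi_hat_word P g 1).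
apply/seteqP; split=> [_ [_ [x /= Px <-] <-] | _ [x /= Px <-]].
  by rewrite gx //; exists x.
by exists (i x); [exists x | apply: gx].
Qed.

Lemma Theta_signalizer : signalizer_functor i (Theta iota).
Proof.
have cent P g : centralizer (img i P) g -> forall x, x \in P -> g * i x = i x * g.
  by move=> Cg x Px; apply: Cg; exists x.
have centT P g : Theta iota P g -> centralizer (img i P) g.
  move/ThetaP => g1 _ [x /= Px <-]; have := hat_word_conj amalG g1 Px.
  by rewrite proj1 // => /(canRL (mulgKV _)).
split=> [P | P Q g sPQ h /ThetaP h1].
  split=> //.
  - split=> [|x y /ThetaP x1 /ThetaP y1]; first by apply/ThetaP; apply: hat_nil.
    apply/ThetaP; have [c [yc c1 _]] := hat_word_inv pS satF amalG y1.
    rewrite lcomp1r in c1; rewrite c1 in yc.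
    by have := hat_word_comp yc x1; rewrite lcomp1l.
  - by move=> g /centT.
  - apply/seteqP; split=> [g [/ThetaP g1 [z /= /setIP[Pz Cz] def_g]] | g -> /=].
      have := hat_word_delta iota Pz; rewrite def_g => gz.
      have E := hat_word_inj pS satF amalG gz g1; rewrite -def_g.
      rewrite (deltaN_free (L := L) (a := lid L P) (z := z)) ?(emb1 amalG) //.
        by rewrite inE (sub Pz).
      by rewrite lcomp1l.
    split; first by apply/ThetaP; apply: hat_nil.
    by exists 1; rewrite /= ?group1 ?(emb1 amalG).
  - apply/seteqP; split=> [_ [_ [z /= Zz <-] [k /centT Ck <-]] | g Cg].
      move=> _ [x /= Px <-]; have [Pz /centP Cz] := setIP Zz.
      rewrite -mulgA (cent _ _ Ck) // !mulgA; congr (_ * _).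
      by rewrite -!(embM amalG) ?(sub Px) ?(sub Pz) // Cz.
    have [||P' [c [gc sP']]] := @hat_word_transport P P g.
    + move=> _ [_ [x /= Px <-] <-]; rewrite (cent _ _ Cg) // mulgK.
      by exists x.
    + exact: cobj_sub.
    have eqP := hat_word_end gc sP'; subst P'.
    have [x Px | z Cz def_c] := @proj_eq _ _ _ _ _ _ (lid L P) c.
      rewrite proj1 //; apply: i_inj; rewrite ?(sub Px) ?(sub (proj_in c Px)) //.
      by rewrite -(hat_word_conj amalG gc Px) (cent _ _ Cg) // mulgK.
    rewrite lcomp1l in def_c; have Pz := fintype.subsetP (cobj_cent P) z Cz.
    exists (i z); first by exists z => //=; rewrite inE Pz; case/setIP: Cz.
    exists (i z^-1 * g); last by rewrite (embV amalG) ?(sub Pz) // mulKVg.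
    apply/ThetaP; have PzV : z^-1 \in P by rewrite groupV.
    have := hat_word_comp gc (hat_word_delta iota PzV).
    rewrite def_c -laut_mulE -deltaNM ?cobj_norm // mulVg deltaN1; exact.
have [P' [c [gc sP'Q]]] := hat_word_transport sPQ (cobj_sub Q).
(* The word of h restricts to P', with composite the identity; conjugate it by
   the word of g. *)
have [P1 [sP1 [d [hd d1]]]] := hat_word_restrict pS satF h1 sP'Q.
have [c' [gc' c'c _]] := hat_word_inv pS satF amalG gc.
rewrite lcomp1l in d1.
exists (g^-1 * h * g); last by rewrite !mulgA mulgV mul1g mulgK.
have sP1P' : P1 \subset P'.
  rewrite (hat_word_im hd); apply/fintype.subsetP => _ /imsetP[x P'x ->].
  have := proj_lcomp (linc L sP1) d P'x.
  by rewrite d1 !proj_linc ?proj_in // => <-.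
have eqP := hat_word_end hd sP1P'; subst P1.
have d_lid : d = lid L P'.
  apply: (lcomp_mono (a := linc L sP1)); rewrite d1 lcomp1r.
  by rewrite (bool_irrelevance sP'Q sP1).
rewrite d_lid in hd; apply/ThetaP.
by have := hat_word_comp gc (hat_word_comp hd gc'); rewrite lcomp1r c'c.
Qed.

End Signalizer.

Theorem proposition4p3 (p : nat) (gT : finGroupType) (S : {group gT})
    (F : fusion_system S) (L : linking_system F)
    (n : nat) (R : 'I_n -> cobj F)
    (G : groupType) (iota : forall v : option 'I_n, laut L (vertex R v) -> G) :
  prime p -> (p.-group S)%g ->
  saturated p F ->
  robinson_amalgam iota ->
  group_model F p (robinson_emb iota) ->
  signalizer_functor (robinson_emb iota) (Theta iota).
Proof.
by move=> p_pr pS satF amalG [_ i_inj _ _]; exact: (Theta_signalizer p_pr pS satF amalG i_inj).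
Qed.
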